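(* Let $i,j\in\{1,\ldots,N\}$, let $\widehat v_i$ be the limit profile for $i$ and $\widehat v_i|_{\Omega_j}(x_j)$ $(0\le x_j<\infty)$ its restriction to $\Omega_j$. Then either $$\lim_{x_j\to\infty}\widehat v_i|_{\Omega_j}(x_j)=1\qquad\text{or}\qquad\lim_{x_j\to\infty}\widehat v_i|_{\Omega_j}(x_j)=0.$$ Furthermore, the former (resp. the latter) holds if and only if $\widehat v_i(\mathrm P_j)>\beta$ (resp. $\widehat v_i(\mathrm P_j)\le\beta$). If the former (resp. the latter) holds, then $\widehat v_i|_{\Omega_j}$ is monotone increasing (resp. decreasing) on $\Omega_j$.
   Context: Metric graphs: a metric graph is a connected graph each of whose edges $E$ is identified with an interval $[0,L_E]$ (finite length $L_E>0$) or $[0,\infty)$ (infinite length); directions of edges only serve to fix coordinates. Multiple edges, loops and vertices of degree $1$ are allowed. Each edge $E$ has a constant thickness $\rho_E>0$; thicknesses of different edges may be unequal. At a vertex $V$ with incident edges $E_1,\ldots,E_m$ (a loop is counted twice), $\frac{\partial u}{\partial\nu_k}(V)$ denotes the derivative of $u$ at $V$ along $E_k$ in the direction pointing from $V$ into the interior of $E_k$; the Kirchhoff condition at $V$ is $\sum_{k=1}^m\rho_{E_k}\frac{\partial u}{\partial\nu_k}(V)=0$. The graph $\Omega$: $\Omega=D\cup\Omega_1\cup\cdots\cup\Omega_N$ with $N\ge2$, where $D$ (the center graph) is a bounded finite metric graph (finitely many edges of finite length; possibly a single vertex) and each outer path $\Omega_i$ is an edge of infinite length with $D\cap\Omega_i=\{\mathrm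 P_i\}$, $\mathrm P_i$ being a vertex of $D$ (the $\mathrm P_i$ are not necessarily distinct). The coordinate on $\Omega_i$ is $x_i\in[0,\infty)$, with $x_i=0$ at $\mathrm P_i$. Nonlinearity: $f\in C^1$ and for some $0<a<1$: $f(0)=f(a)=f(1)=0$, $f<0$ on $(0,a)$, $f>0$ on $(a,1)$, $f'(0)<0$, $f'(a)>0$, $f'(1)<0$, $\int_0^1f(s)\,ds>0$. $F(s)=\int_0^sf(r)\,dr$, and $\beta$ is the unique value in $(a,1)$ with $F(\beta)=0$. Solution of $\partial_tu=\Delta_\Omega u+f(u)$ on a time interval: a function $u(t,x)$ continuous in $(t,x)$ that satisfies $\partial_tu=\partial_x^2u+f(u)$ on each edge except at endpoints, with $\partial_xu$ continuous on each edge up to the endpoints, and the Kirchhoff condition at every vertex. Traveling wave: $(\phi,c)$, $c>0$, is the unique pair with $\phi''+c\phi'+f(\phi)=0$ and $0<\phi<1$ on $\mathbb R$, $\phi(-\infty)=1$, $\phi(+\infty)=0$, $\phi(0)=a$. Front-like solution and limit profile: for each $i$ there is a unique entire solution $\widehat u_i$ (defined for all $t\in\mathbb R$) with $0<\widehat u_i<1$ and $\lim_{t\to-\infty}\big(\sup_{x_i\in\Omega_i}|\widehat u_i|_{\Omega_i}(t,x_i)-\phi(-x_i-ct)|+\sup_{\Omega\setminus\Omega_i}|\widehat u_i(t,\cdot)|\big)=0$; it is strictly increasing in $t$. The limit profile is $\widehat v_i(x)=\lim_{t\to\infty}\widehat u_i(t,x)$.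
   Formalization: For i=j only two implications are kept (value at P_j above β gives limit 1; limit 0 gives value at most β): there the limit is always 1, yet a blocked front on a star graph can have value at most β at P_i, so the stated equivalences fail. They are proved in full for i≠j. *)

(* Defs.v *)
From HB Require Import structures.
From mathcomp Require Import all_boot all_order all_algebra.
From mathcomp Require Import all_classical all_reals all_analysis.
Set Implicit Arguments.
Unset Strict Implicit.
Unset Printing Implicit Defensive.
Import Order.TTheory GRing.Theory Num.Theory.
Import numFieldNormedType.Exports.
Local Open Scope classical_set_scope.
Local Open Scope ring_scope.

(* The graph Omega = D \cup Omega_1 \cup ... \cup Omega_N. The bounded edge k
   of D is [0, clen k], running from csrc k to ctgt k; loops and multiple edges
   are allowed, and cedge may be empty. The outer path Omega_i is [0, +oo[
   with its origin glued to attach i, the vertex P_i. *)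
Record mgraph (R : realType) (N : nat) := MGraph {
  vertex : finType;
  cedge : finType;
  csrc : cedge -> vertex;
  ctgt : cedge -> vertex;
  clen : cedge -> R;
  attach : 'I_N -> vertex;
  thickness : cedge + 'I_N -> R;
  clen_gt0 : forall k, 0 < clen k;
  thickness_gt0 : forall e, 0 < thickness e;
  center_connected : forall V W : vertex,
    connect (fun A B => [exists k, (csrc k == A) && (ctgt k == B)
                                || (csrc k == B) && (ctgt k == A)]) V W
}.

Arguments attach {R N} m i.
Arguments thickness {R N} m e.

Section Graph.
Context {R : realType} {N : nat} (G : mgraph R N).

Definition gedge : Type := (cedge G + 'I_N)%type.

Definition edge_dom (e : gedge) : set R :=
  match e with
  | inl k => [set x | 0 <= x <= clen k]
  | inr _ => [set x | 0 <= x]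
  end.

Definition edge_int (e : gedge) : pred R :=
  fun x => match e with inl k => 0 < x < clen k | inr _ => 0 < x end.

Inductive gpoint : Type :=
| Vtx of vertex G
| Inner (e : gedge) of {x : R | edge_int e x}.

(* The point with coordinate x on the closed edge e; coordinates outside
   edge_dom e are sent to the nearest endpoint. A function w on Omega is
   restricted to e by composing it with gpt e. *)
Definition gpt (e : gedge) (x : R) : gpoint :=
  match insub x : option {y : R | edge_int e y} with
  | Some y => Inner y
  | None => Vtx (match e with
                 | inl k => if x <= 0 then csrc k else ctgt k
                 | inr i => attach G i
                 end)
  end.

Definition outer (i : 'I_N) (x : R) : gpoint := gpt (inr i) x.

Definition outer_path (i : 'I_N) : set gpoint := outer i @` [set x | 0 <= x].

(* Difference quotients on the closed edge e: at an endpoint the limit is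
   the one-sided derivative. *)
Definition edge_quot (e : gedge) (w : gpoint -> R) (x : R) : set_system R :=
  ((w (gpt e y) - w (gpt e x)) / (y - x)) @[y --> within (edge_dom e) x^'].

Definition edge_derive (e : gedge) (w : gpoint -> R) (x : R) : R :=
  lim (edge_quot e w x).

Definition C1_on_edge (e : gedge) (w : gpoint -> R) : Prop :=
  (forall x, edge_dom e x -> cvg (edge_quot e w x)) /\
  {within edge_dom e, continuous (edge_derive e w)}.

(* A loop at V contributes to both of the first two sums. *)
Definition kirchhoff (w : gpoint -> R) (V : vertex G) : Prop :=
  \sum_(k : cedge G | csrc k == V)
     thickness G (inl k) * edge_derive (inl k) w 0
  + \sum_(k : cedge G | ctgt k == V)
     thickness G (inl k) * (- edge_derive (inl k) w (clen k))
  + \sum_(i < N | attach G i == V)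
     thickness G (inr i) * edge_derive (inr i) w 0 = 0.

Record entire_solution (f : R -> R) (u : R -> gpoint -> R) : Prop := {
  sol_continuous : forall e : gedge,
    {within [set tx : R * R | edge_dom e tx.2],
       continuous (fun tx : R * R => u tx.1 (gpt e tx.2))};
  sol_C1 : forall (t : R) (e : gedge), C1_on_edge e (u t);
  sol_derivable_t : forall (t : R) (e : gedge) (x : R), edge_int e x ->
    derivable (fun s => u s (gpt e x)) t 1;
  sol_derivable_xx : forall (t : R) (e : gedge) (x : R), edge_int e x ->
    derivable (edge_derive e (u t)) x 1;
  sol_equation : forall (t : R) (e : gedge) (x : R), edge_int e x ->
    derive1 (fun s => u s (gpt e x)) t
      = derive1 (edge_derive e (u t)) x + f (u t (gpt e x));
  sol_kirchhoff : forall (t : R) (V : vertex G), kirchhoff (u t) V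
}.

(* Both suprema are over bounded sets whenever 0 < u < 1 and 0 < phi < 1;
   the second set is nonempty as soon as N >= 2. *)
Definition front_like (f phi : R -> R) (c : R) (i : 'I_N)
    (u : R -> gpoint -> R) : Prop :=
  [/\ entire_solution f u,
      (forall (t : R) (p : gpoint), 0 < u t p < 1)
    & (sup [set `|u t (outer i x) - phi (- x - c * t)| | x in [set x | 0 <= x]]
       + sup [set `|u t p| | p in ~` outer_path i]) @[t --> -oo] --> (0 : R)].

Definition limit_profile (u : R -> gpoint -> R) (v : gpoint -> R) : Prop :=
  forall p, u t p @[t --> +oo] --> v p.

End Graph.

(* Only used for s >= 0. *)
Definition primitive {R : realType} (f : R -> R) (s : R) : R :=
  (\int[@lebesgue_measure R]_(r in `[0%R, s]) f r)%R.

Record bistable {R : realType} (f : R -> R) (a : R) : Prop := {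
  bistable_a : 0 < a < 1;
  bistable_derivable : forall s : R, derivable f s 1;
  bistable_C1 : continuous (derive1 f);
  bistable_f0 : f 0 = 0;
  bistable_fa : f a = 0;
  bistable_f1 : f 1 = 0;
  bistable_neg : forall s : R, 0 < s < a -> f s < 0;
  bistable_pos : forall s : R, a < s < 1 -> 0 < f s;
  bistable_df0 : derive1 f 0 < 0;
  bistable_dfa : 0 < derive1 f a;
  bistable_df1 : derive1 f 1 < 0;
  bistable_int : 0 < primitive f 1
}.

Record traveling_wave {R : realType} (f : R -> R) (a : R) (phi : R -> R) (c : R)
    : Prop := {
  wave_speed : 0 < c;
  wave_derivable : forall z : R, derivable phi z 1;
  wave_derivable2 : forall z : R, derivable (derive1 phi) z 1;
  wave_equation : forall z : R,
    derive1 (derive1 phi) z + c * derive1 phi z + f (phi z) = 0;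
  wave_range : forall z : R, 0 < phi z < 1;
  wave_ninfty : phi z @[z --> -oo] --> (1 : R);
  wave_pinfty : phi z @[z --> +oo] --> (0 : R);
  wave_norm : phi 0 = a
}.

(* Main.v *)
Require Import Defs.
From HB Require Import structures.
From mathcomp Require Import all_boot all_order all_algebra.
From mathcomp Require Import all_classical all_reals all_analysis.
From mathcomp Require Import ring lra.
Set Implicit Arguments.
Unset Strict Implicit.
Unset Printing Implicit Defensive.
Import Order.TTheory GRing.Theory Num.Theory.
Import numFieldNormedType.Exports.
Local Open Scope classical_set_scope.
Local Open Scope ring_scope.

(** On the outer path [Omega_j] the limit profile [v] solves [v'' + f (v) = 0] with values
in [[0, 1]]. The potential [F] vanishes at 0 and [beta] and is negative in between. In the
phase plane, a steady state which exceeds [beta] somewhere has positive energy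
[v'^2 / 2 + F (v)] and can only increase to 1. Starting from a level at most [beta], by
contrast, there are also periodic orbits, the constant [a], bumps, and an orbit climbing to
1, which only the parabolic problem can exclude. All parabolic facts are drawn from the weak
maximum principle and explicit barriers.

1. Order in time. For a large delay [h] one has [u (h + t) >= u t] on the whole graph
([front_delay_order]). In the remote past, wherever the inequality fails both values are
close to the same stable zero of [f], which damps the difference ([ancient_nonneg]); later
times follow by comparison on the graph ([comparison_graph]), where a perturbation with
negative Kirchhoff sum prevents a minimum at a vertex. Hence [u t <= v] for all [t]. In
particular, if [i = j] then [v] exceeds [beta] far out on the path, as [u t] already does.

2. Steady limit. Convergence at one point [x1] controls the solution near [x1] at large
times by a barrier with a fixed linear modulus ([boundary_modulus]). So [v] is Lipschitz and
the convergence is locally uniform; comparing [u] on an interval with the solution of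
[p'' = - f (v)] that agrees with [v] at its ends then gives [v = p] ([profile_steady]).

3. Above [beta]. If [v] exceeds [beta] at a point of the path, the energy argument shows
that it is nondecreasing on the whole path and tends to 1 ([steady_above_beta]).

4. Below [beta]. Let [i <> j] and [v <= beta] at a point [x1] of the path. The homoclinic
orbit decreasing from [beta] to 0 ([homoclinic_exists]), started at the level [v x1], is a
steady state which dominates [u] on the boundary because [u t <= v], and in the past because
[u] is small on [Omega_j]. Hence it dominates [u] at all times, and [v] beyond [x1]
([profile_blocked]). So [v] tends to 0, and since [x1] can be any point of the path as soon
as [v] stays below [beta], [v] is nonincreasing. *)

(** * Calculus in one variable *)

Section Calculus.
Context {R : realType}.
Implicit Types (f g : R -> R) (x y a b : R).

Lemma is_derive_fun_cst x (c : R) : is_derive x 1 (fun=> c) 0.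
Proof. exact: is_derive_cst. Qed.

Lemma is_derive_fun_id x : is_derive x 1 (fun y : R => y) 1.
Proof. exact: is_derive_id. Qed.

Lemma is_derive_fun_add f g x (a b : R) : is_derive x 1 f a -> is_derive x 1 g b ->
  is_derive x 1 (fun y => f y + g y) (a + b).
Proof. by move=> h1 h2; exact: is_deriveD. Qed.

Lemma is_derive_fun_sub f g x (a b : R) : is_derive x 1 f a -> is_derive x 1 g b ->
  is_derive x 1 (fun y => f y - g y) (a - b).
Proof. by move=> h1 h2; exact: is_deriveB. Qed.

Lemma is_derive_fun_opp f x (a : R) : is_derive x 1 f a ->
  is_derive x 1 (fun y => - f y) (- a).
Proof. by move=> h1; exact: is_deriveN. Qed.

Lemma is_derive_fun_mul f g x (a b : R) : is_derive x 1 f a -> is_derive x 1 g b ->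
  is_derive x 1 (fun y => f y * g y) (a * g x + f x * b).
Proof.
move=> h1 h2; have h : is_derive x 1 (f * g) (f x *: b + g x *: a).
  exact: is_deriveM.
by apply: is_derive_eq h _; rewrite /GRing.scale /=; ring.
Qed.

Lemma is_derive_fun_scale f x (c a : R) : is_derive x 1 f a ->
  is_derive x 1 (fun y => c * f y) (c * a).
Proof. by move=> h; exact: (@is_deriveZ _ _ _ f c x 1 a). Qed.

Lemma is_derive_fun_comp f g x (a b : R) : is_derive (g x) 1 f a ->
  is_derive x 1 g b -> is_derive x 1 (fun y => f (g y)) (a * b).
Proof. by move=> h1 h2; exact: is_derive1_comp. Qed.

Lemma is_derive_fun_sqr f x (a : R) : is_derive x 1 f a ->
  is_derive x 1 (fun y => f y ^+ 2) (2 * f x * a).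
Proof.
move=> h; have := is_derive_fun_mul h h.
rewrite (_ : (fun y => f y * f y) = (fun y => f y ^+ 2)).
  by move=> h'; apply: is_derive_eq h' _; ring.
by apply/funext => y; rewrite expr2.
Qed.

Lemma is_derive_fun_shift f x (c a : R) : is_derive (c + x) 1 f a ->
  is_derive x 1 (fun y => f (c + y)) a.
Proof.
move=> h; have h2 : is_derive x 1 (fun y => c + y) (0 + 1).
  exact: (is_derive_fun_add (is_derive_fun_cst _ _) (is_derive_fun_id _)).
by apply: is_derive_eq (is_derive_fun_comp h h2) _; ring.
Qed.

Lemma is_derive_continuous f x (a : R) : is_derive x 1 f a -> {for x, continuous f}.
Proof.
by move=> [h _]; exact/differentiable_continuous/derivable1_diffP.
Qed.

Lemma is_derive_cvg_quot f x (a : R) : is_derive x 1 f a ->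
  (f y - f x) / (y - x) @[y --> x^'] --> a.
Proof.
move=> /is_derive1_caratheodory[g [fE gc gx]].
have : g y @[y --> x^'] --> a.
  by rewrite -gx; apply: cvg_trans gc; exact: cvg_app (@nbhs_dnbhs _ x).
apply: cvg_trans; apply: near_eq_cvg.
near=> y; rewrite fE mulfK// subr_eq0.
by near: y; exact: nbhs_dnbhs_neq.
Unshelve. all: by end_near. Qed.

Lemma cvg_quot_is_derive f x (a : R) :
  (f y - f x) / (y - x) @[y --> x^'] --> a -> is_derive x 1 f a.
Proof.
move=> h; apply/is_derive1_caratheodory.
exists (fun z => if z == x then a else (f z - f x) / (z - x)); split.
- move=> z; case: eqP => [->|/eqP zx]; first by rewrite !subrr mulr0.
  by rewrite mulfVK// subr_eq0.
- apply/continuous_withinNx; rewrite eqxx; apply: cvg_trans h.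
  apply: near_eq_cvg; near=> y; rewrite ifN//.
  by near: y; exact: nbhs_dnbhs_neq.
- by rewrite eqxx.
Unshelve. all: by end_near. Qed.

Lemma dnbhs_at_right x : (x^'+ : set_system R) `=>` x^'.
Proof.
move=> A /nbhs_ballP[e /= e0 he]; apply/nbhs_ballP; exists e => //= y ye xy.
by apply: he => //; rewrite gt_eqF.
Qed.

Lemma dnbhs_at_left x : (x^'- : set_system R) `=>` x^'.
Proof.
move=> A /nbhs_ballP[e /= e0 he]; apply/nbhs_ballP; exists e => //= y ye xy.
by apply: he => //; rewrite lt_eqF.
Qed.

Lemma near_at_right (P : set R) x : (\forall y \near x, P y) -> \forall y \near x^'+, P y.
Proof. by move=> h; apply: dnbhs_at_right; exact: nbhs_dnbhs. Qed.

Lemma near_at_left (P : set R) x : (\forall y \near x, P y) -> \forall y \near x^'-, P y.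
Proof. by move=> h; apply: dnbhs_at_left; exact: nbhs_dnbhs. Qed.

Lemma derive_pos_right f x (d : R) : is_derive x 1 f d -> 0 < d ->
  \forall y \near x^'+, f x < f y.
Proof.
move=> /is_derive_cvg_quot h d0.
have h' : (f y - f x) / (y - x) @[y --> x^'+] --> d.
  by apply: cvg_trans h; exact: cvg_app (@dnbhs_at_right x).
near=> y.
have xy : 0 < y - x by rewrite subr_gt0; near: y; exact: nbhs_right_gt.
have : 0 < (f y - f x) / (y - x) by near: y; exact: cvgr_gt h' _ d0.
by rewrite pmulr_lgt0 ?invr_gt0// subr_gt0.
Unshelve. all: by end_near. Qed.

Lemma derive_pos_left f x (d : R) : is_derive x 1 f d -> 0 < d ->
  \forall y \near x^'-, f y < f x.
Proof.
move=> /is_derive_cvg_quot h d0.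
have h' : (f y - f x) / (y - x) @[y --> x^'-] --> d.
  by apply: cvg_trans h; exact: cvg_app (@dnbhs_at_left x).
near=> y.
have xy : y - x < 0 by rewrite subr_lt0; near: y; exact: nbhs_left_lt.
have : 0 < (f y - f x) / (y - x) by near: y; exact: cvgr_gt h' _ d0.
by rewrite nmulr_lgt0 ?invr_lt0// subr_lt0.
Unshelve. all: by end_near. Qed.

Lemma is_derive_le_of_left_min f x (d : R) : is_derive x 1 f d ->
  (\forall y \near x^'-, f x <= f y) -> d <= 0.
Proof.
move=> h hm; rewrite leNgt; apply/negP => d0.
have [y [hy1 hy2]] : exists y, f x <= f y /\ f y < f x.
  by apply: (@filter_ex _ x^'-); exact: filterI hm (derive_pos_left h d0).
by move: (lt_le_trans hy2 hy1); rewrite ltxx.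
Qed.

Lemma is_derive_ge_of_right_min f x (d : R) : is_derive x 1 f d ->
  (\forall y \near x^'+, f x <= f y) -> 0 <= d.
Proof.
move=> h hm; rewrite leNgt; apply/negP => d0.
have := derive_pos_right (is_derive_fun_opp h); rewrite oppr_gt0 => /(_ d0) hr.
have [y [hy1 hy2]] : exists y, f x <= f y /\ - f y > - f x.
  by apply: (@filter_ex _ x^'+); exact: filterI hm hr.
by move: hy2; rewrite ltrN2 ltNge hy1.
Qed.

Lemma near_between x (l r : R) : l < x < r -> \forall y \near x, l < y < r.
Proof.
move=> xI; have xI' : x \in `]l, r[ by rewrite in_itv.
by have := near_in_itvoo xI'; apply: filterS => y; rewrite in_itv.
Qed.

Lemma near_above x (l : R) : l < x -> \forall y \near x, l < y.
Proof.
move=> lx; have : \forall y \near x, l < y < x + 1 by apply: near_between; lra.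
by apply: filterS => y /andP[].
Qed.

Lemma at_right_ex (P : set R) x : (\forall y \near x^'+, P y) ->
  exists2 e, 0 < e & forall y, x < y < x + e -> P y.
Proof.
move=> /nbhs_ballP[e /= e0 he]; exists e => // y /andP[xy ye]; apply: he => //=.
by rewrite /ball /= ltr_norml; apply/andP; split; lra.
Qed.

(** The first derivative is an arbitrary witness rather than [derive1 f], so that the
edge derivative of a solution, one-sided at the endpoints, can serve. *)
Definition has_d2 f x (d : R) := exists f1 : R -> R,
  (\forall y \near x, is_derive (y : R) 1 f (f1 y)) /\ is_derive x 1 f1 d.

Lemma has_d2_add f g x (a b : R) : has_d2 f x a -> has_d2 g x b ->
  has_d2 (fun y => f y + g y) x (a + b).
Proof.
move=> [f1 [hf hf1]] [g1 [hg hg1]]; exists (fun y => f1 y + g1 y); split.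
  by apply: filterS2 hf hg => y ? ?; exact: is_derive_fun_add.
exact: is_derive_fun_add.
Qed.

Lemma has_d2_scale f x (c a : R) : has_d2 f x a -> has_d2 (fun y => c * f y) x (c * a).
Proof.
move=> [f1 [hf hf1]]; exists (fun y => c * f1 y); split.
  by apply: filterS hf => y ?; exact: is_derive_fun_scale.
exact: is_derive_fun_scale.
Qed.

Lemma has_d2_sub f g x (a b : R) : has_d2 f x a -> has_d2 g x b ->
  has_d2 (fun y => f y - g y) x (a - b).
Proof.
move=> hf hg; have := has_d2_add hf (has_d2_scale (-1) hg).
by under eq_fun do rewrite mulN1r; rewrite mulN1r.
Qed.

Lemma has_d2_shift f x (c a : R) : has_d2 f (c + x) a -> has_d2 (fun y => f (c + y)) x a.
Proof.
move=> [f1 [hf hf1]]; exists (fun y => f1 (c + y)); split; last exact: is_derive_fun_shift.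
have hc : c + y @[y --> x] --> c + x by apply: cvgD; [exact: cvg_cst|exact: cvg_id].
have : \forall y \near x, is_derive (c + y) 1 f (f1 (c + y)) by exact: (hc _ hf).
by apply: filterS => y; exact: is_derive_fun_shift.
Qed.

Lemma has_d2_quadratic x (A B C : R) : has_d2 (fun y => A + B * y + C * y ^+ 2) x (2 * C).
Proof.
exists (fun y => B + 2 * C * y); split.
  near=> y.
  have h1 : is_derive y 1 (fun y => A + B * y + C * y ^+ 2)
      ((0 + B * 1) + C * (2 * y * 1)).
    exact: (is_derive_fun_add
      (is_derive_fun_add (is_derive_fun_cst _ _) (is_derive_fun_scale _ (is_derive_fun_id _)))
      (is_derive_fun_scale _ (is_derive_fun_sqr (is_derive_fun_id _)))).
  by apply: is_derive_eq h1 _; ring.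
have h1 : is_derive x 1 (fun y => B + 2 * C * y) (0 + 2 * C * 1).
  exact: (is_derive_fun_add (is_derive_fun_cst _ _) (is_derive_fun_scale _ (is_derive_fun_id _))).
by apply: is_derive_eq h1 _; ring.
Unshelve. all: by end_near. Qed.

Lemma has_d2_min f x (d : R) : has_d2 f x d -> (\forall y \near x, f x <= f y) -> 0 <= d.
Proof.
move=> [f1 [hf hf1]] hm.
have hx : is_derive x 1 f (f1 x) by exact: nbhs_singleton hf.
have f1x : f1 x = 0.
  apply/eqP; rewrite eq_le; apply/andP; split.
    exact: is_derive_le_of_left_min hx (near_at_left hm).
  exact: is_derive_ge_of_right_min hx (near_at_right hm).
rewrite leNgt; apply/negP => d0.
(* f1 vanishes at x and is negative immediately to its right, so f decreases there *)
have := derive_pos_right (is_derive_fun_opp hf1); rewrite oppr_gt0 => /(_ d0) hr.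
have [e e0 he] := at_right_ex (filterI hr (filterI (near_at_right hf) (near_at_right hm))).
have hxy : x < x + e / 2 by lra.
have hd y : x <= y < x + e -> is_derive y 1 f (f1 y).
  rewrite le_eqVlt => /andP[/predU1P[<-//|xy] ye].
  by have [_ []] := he y ltac:(by rewrite xy ye).
have [c /[!in_itv]/= /andP[c1 c2] E] := MVT hxy
  (fun y (hy : y \in `]x, x + e / 2[) =>
     hd y ltac:(by move: hy; rewrite in_itv/= => /andP[? ?]; apply/andP; split; lra))
  (derivable_within_continuous (fun y (hy : y \in `[x, x + e / 2]) =>
     @ex_derive _ _ _ _ _ _ _ (hd y ltac:(by move: hy; rewrite in_itv/= => /andP[? ?]; apply/andP; split; lra)))).
have [+ _] := he c ltac:(by apply/andP; split; lra).
have [_ [_]] := he (x + e / 2) ltac:(by apply/andP; split; lra).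
rewrite f1x oppr0 oppr_gt0 -subr_ge0 E => h1 h2.
by move: h1; rewrite leNgt nmulr_rlt0//; lra.
Qed.
End Calculus.

(** * Comparison principles on an interval and on a half-line *)

Section Comparison.
Context {R : realType}.
Implicit Types (z w : R -> R -> R) (t x : R).

(** The differential inequality [z_t - z_xx >= m] at a single point: the comparison
arguments require it only where [z] is negative. *)
Definition heat_ge z t x (m : R) := exists zt zxx : R,
  [/\ is_derive t 1 (fun s => z s x) zt, has_d2 (z t) x zxx & m <= zt - zxx].

Lemma heat_ge_add z w t x (m n : R) : heat_ge z t x m -> heat_ge w t x n ->
  heat_ge (fun t x => z t x + w t x) t x (m + n).
Proof.
move=> [zt [zxx [h1 h2 h3]]] [wt [wxx [h4 h5 h6]]]; exists (zt + wt), (zxx + wxx).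
by split; [exact: is_derive_fun_add|exact: has_d2_add|lra].
Qed.

Lemma heat_ge_le z t x (m n : R) : heat_ge z t x m -> n <= m -> heat_ge z t x n.
Proof.
by move=> [zt [zxx [h1 h2 h3]]] nm; exists zt, zxx; split => //; lra.
Qed.

Lemma is_derive_expR_affine (k t0 t : R) :
  is_derive t 1 (fun s => expR (k * (s - t0))) (k * expR (k * (t - t0))).
Proof.
have h : is_derive t 1 (fun s => k * (s - t0)) (k * (1 - 0)).
  exact: (is_derive_fun_scale _ (is_derive_fun_sub (is_derive_fun_id _) (is_derive_fun_cst _ _))).
by apply: is_derive_eq (is_derive_fun_comp (is_derive_expR _) h) _; ring.
Qed.

(** An exponential weight in time trades for a zero-order term, which the comparison
principles use to remove or to create damping. *)
Lemma heat_ge_weight (k t0 : R) z t x (m : R) : heat_ge z t x m ->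
  heat_ge (fun t x => expR (k * (t - t0)) * z t x) t x
    (expR (k * (t - t0)) * (m + k * z t x)).
Proof.
move=> [zt [zxx [h1 h2 h3]]].
exists (k * expR (k * (t - t0)) * z t x + expR (k * (t - t0)) * zt),
  (expR (k * (t - t0)) * zxx); split.
- exact: is_derive_fun_mul (is_derive_expR_affine _ _ _) h1.
- exact: has_d2_scale.
- have := ler_wpM2l (expR_ge0 (k * (t - t0))) h3; lra.
Qed.

Lemma heat_ge_poly (A B C D : R) t x (t0 : R) :
  heat_ge (fun t x => A + B * x + C * x ^+ 2 + D * (t - t0)) t x (D - 2 * C).
Proof.
exists (0 + D * (1 - 0)), (2 * C - 0); split.
- exact: (is_derive_fun_add (is_derive_fun_cst _ _)
    (is_derive_fun_scale _ (is_derive_fun_sub (is_derive_fun_id _) (is_derive_fun_cst _ _)))).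
- have h : has_d2 (fun x : R => D * (t - t0) + 0 * x + 0 * x ^+ 2) x (2 * 0).
    exact: has_d2_quadratic.
  have := has_d2_add (has_d2_quadratic x A B C) h.
  rewrite (_ : (fun y => _ + _) = (fun x => A + B * x + C * x ^+ 2 + D * (t - t0))).
    by rewrite mulr0 addr0 subr0.
  by apply/funext => y; ring.
- lra.
Qed.

(** At a space-time minimum reached from earlier times, [z_t <= 0 <= z_xx]. *)
Lemma no_interior_min z (t0 t x m : R) : t0 < t -> 0 < m -> heat_ge z t x m ->
  (forall s, t0 <= s <= t -> z t x <= z s x) ->
  (\forall y \near x, z t x <= z t y) -> False.
Proof.
move=> t0t m0 [zt [zxx [h1 h2 h3]]] hs hx.
have := has_d2_min h2 hx.
have : zt <= 0.
  apply: is_derive_le_of_left_min h1 _; near=> s; apply: hs; apply/andP; split.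
    by near: s; exact: nbhs_left_ge.
  by near: s; exact: nbhs_left_le.
lra.
Unshelve. all: by end_near. Qed.

Definition rect (t0 t1 l r : R) : set (R * R) :=
  [set p | t0 <= p.1 <= t1 /\ l <= p.2 <= r].

Lemma rect_min (Z : R * R -> R) (t0 t1 l r : R) : t0 <= t1 -> l <= r ->
  {within rect t0 t1 l r, continuous Z} ->
  exists2 c, rect t0 t1 l r c & forall p, rect t0 t1 l r p -> Z c <= Z p.
Proof.
move=> t01 lr cZ.
have E : rect t0 t1 l r = `[t0, t1] `*` `[l, r].
  by apply/seteqP; split => p /=; rewrite !in_itv /rect.
have h0 : rect t0 t1 l r !=set0 by exists (t0, l); rewrite /rect /= !lexx t01 lr.
have hc : compact (rect t0 t1 l r).
  by rewrite E; apply: compact_setX; exact: segment_compact.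
have [c /set_mem hcR hm] := compact_EVT_min h0 hc cZ.
by exists c => // p hp; apply: hm; rewrite inE.
Qed.

Lemma continuous_within_weight (A : set (R * R)) z (k t0 : R) (g : R * R -> R) :
  {within A, continuous (fun p => z p.1 p.2)} -> continuous g ->
  {within A, continuous (fun p : R * R => expR (k * (p.1 - t0)) * z p.1 p.2 + g p)}.
Proof.
move=> hz hg p; apply: cvgD; last exact: (continuous_subspaceT hg).
apply: cvgM; last exact: hz.
apply: (@continuous_subspaceT _ _ A (fun p : R * R => expR (k * (p.1 - t0)))) => {}p.
apply: (@continuous_comp _ _ _ (fun p : R * R => k * (p.1 - t0)) expR); last exact: continuous_expR.
apply: cvgM; first exact: cvg_cst.
apply: cvgB; last exact: cvg_cst.
exact: cvg_fst.
Qed.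

(** With the weight [exp (- k (t - t0))] the zero-order term disappears, and adding
[eps (1 + t - t0)] makes the differential inequality strict. The minimum of the result, if
negative, lies off the parabolic boundary, where a strict inequality is impossible. *)
Lemma comparison_interval z (t0 t1 l r k : R) : l <= r ->
  {within rect t0 t1 l r, continuous (fun p => z p.1 p.2)} ->
  (forall x, l <= x <= r -> 0 <= z t0 x) ->
  (forall t, t0 <= t <= t1 -> 0 <= z t l /\ 0 <= z t r) ->
  (forall t x, t0 < t <= t1 -> l < x < r -> z t x < 0 -> heat_ge z t x (k * z t x)) ->
  forall t x, t0 <= t <= t1 -> l <= x <= r -> 0 <= z t x.
Proof.
move=> lr cz z0 zb zi t x tt xx; rewrite leNgt; apply/negP => ztx.
have t01 : t0 <= t1 by lra.
pose e := - (expR ((- k) * (t - t0)) * z t x) / (2 * (1 + (t - t0))).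
have e0 : 0 < e.
  by rewrite /e divr_gt0//; [rewrite oppr_gt0 pmulr_rlt0 ?expR_gt0|lra].
pose Z t x := expR ((- k) * (t - t0)) * z t x + (e + 0 * x + 0 * x ^+ 2 + e * (t - t0)).
have Ztx : Z t x < 0.
  have : e * (2 * (1 + (t - t0))) = - (expR ((- k) * (t - t0)) * z t x).
    by rewrite /e mulfVK//; lra.
  have : expR ((- k) * (t - t0)) * z t x < 0 by rewrite pmulr_rlt0 ?expR_gt0.
  rewrite /Z; lra.
have cZ : {within rect t0 t1 l r, continuous (fun p => Z p.1 p.2)}.
  apply: (@continuous_within_weight _ z (- k) t0
    (fun p : R * R => e + 0 * p.2 + 0 * p.2 ^+ 2 + e * (p.1 - t0))) => // p.
  rewrite (_ : (fun _ => _) = (fun p : R * R => e + e * (p.1 - t0))); last first.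
    by apply/funext => q; ring.
  apply: cvgD; first exact: cvg_cst.
  apply: cvgM; first exact: cvg_cst.
  by apply: cvgB; [exact: cvg_fst|exact: cvg_cst].
have [[s y] [/= sI yI] hm] := rect_min t01 lr cZ.
have Zs : Z s y < 0 by apply: le_lt_trans Ztx; apply: (hm (t, x)); split.
have zs : z s y < 0.
  have h1 : 0 <= e * (s - t0) by rewrite mulr_ge0//; lra.
  have : expR ((- k) * (s - t0)) * z s y < 0 by move: Zs; rewrite /Z; lra.
  by rewrite pmulr_rlt0 ?expR_gt0.
have s0 : t0 < s.
  rewrite lt_neqAle; apply/andP; split; last by lra.
  by apply/eqP => E; move: zs; rewrite -E ltNge z0.
have yl : l < y.
  rewrite lt_neqAle; apply/andP; split; last by lra.
  by apply/eqP => E; move: zs; rewrite -E ltNge (zb s sI).1.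
have yr : y < r.
  rewrite lt_neqAle; apply/andP; split; last by lra.
  by apply/eqP => E; move: zs; rewrite E ltNge (zb s sI).2.
have hh := heat_ge_weight (- k) t0 (zi s y ltac:(lra) ltac:(lra) zs).
have hZ : heat_ge Z s y e.
  apply: heat_ge_le (heat_ge_add hh (heat_ge_poly e 0 0 e s y t0)) _.
  by rewrite le_eqVlt; apply/orP; left; apply/eqP; ring.
apply: (no_interior_min s0 e0 hZ) => [s' s'I|].
  by apply: (hm (s', y)); split => //=; lra.
have : \forall y' \near y, l < y' < r by apply: near_between; rewrite yl.
by apply: filterS => y' yI'; apply: (hm (s, y')); split => //=; lra.
Qed.

(** On an unbounded edge the quadratic [x^2 + 2 (t - t0)], a solution of the heat
equation, dominates the bounded function [z] far away, so that the comparison takes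
place on a bounded interval. *)
Lemma comparison_halfline z (t0 t1 k C C0 : R) : 0 <= C0 ->
  {within [set p : R * R | 0 <= p.2], continuous (fun p => z p.1 p.2)} ->
  (forall t x, t0 <= t <= t1 -> 0 <= x -> - C <= z t x) ->
  (forall x, 0 <= x -> - C0 <= z t0 x) ->
  (forall t, t0 <= t <= t1 -> 0 <= z t 0) ->
  (forall t x, t0 < t <= t1 -> 0 < x -> z t x < 0 -> heat_ge z t x (k * z t x)) ->
  forall t x, t0 <= t <= t1 -> 0 <= x -> - C0 * expR (k * (t - t0)) <= z t x.
Proof.
move=> C00 cz zC z0 zb zi t x tt xx; rewrite leNgt; apply/negP => ztx.
(* w = exp (-k (t - t0)) z satisfies the comparison inequality with k = 0 *)
pose w t x := expR ((- k) * (t - t0)) * z t x.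
have wz s y : z s y = expR (k * (s - t0)) * w s y.
  by rewrite /w mulrA -expRD mulNr subrr expR0 mul1r.
have wlt : w t x < - C0.
  by move: ztx; rewrite wz [ltRHS]mulrC ltr_pM2l ?expR_gt0.
pose B := x ^+ 2 + 2 * (t - t0).
have B0 : 0 <= B by rewrite /B addr_ge0 ?sqr_ge0//; lra.
pose e := (- C0 - w t x) / (2 * (1 + B)).
have e0 : 0 < e by rewrite /e divr_gt0//; lra.
pose Z t x := w t x + (C0 + 0 * x + e * x ^+ 2 + (2 * e) * (t - t0)).
have Ztx : Z t x < 0.
  have : e * (2 * (1 + B)) = - C0 - w t x by rewrite /e mulfVK//; lra.
  by rewrite /Z /B in B0 *; nra.
pose E := expR (`|k| * (t1 - t0)).
have [X [X1 X2]] : exists X, x <= X /\ `|C| * E <= e * X ^+ 2.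
  exists (x + 1 + `|C| * E / e); have h : 0 <= `|C| * E / e.
    by apply: divr_ge0; [apply: mulr_ge0 => //; exact: expR_ge0|exact: ltW].
  split; first lra.
  rewrite [leLHS](_ : _ = e * (`|C| * E / e)); last by rewrite [RHS]mulrC mulfVK// gt_eqF.
  by rewrite ler_pM2l//; set h' := `|C| * E / e in h *; nra.
have wC s y : t0 <= s <= t1 -> 0 <= y -> - (`|C| * E) <= w s y.
  move=> sI y0; rewrite /w lerNl -mulrN.
  have h1 : - z s y <= `|C| by have := zC s y sI y0; have := ler_norm C; lra.
  have h2 : expR (- k * (s - t0)) <= E.
    rewrite /E ler_expR; have : - k <= `|k| by rewrite -normrN ler_norm.
    have : 0 <= `|k| by []. nra.
  have h3 := expR_ge0 (- k * (s - t0)).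
  have h4 : 0 <= `|C| by []. nra.
have : 0 <= Z t x; last by lra.
have cw : {within [set p : R * R | 0 <= p.2], continuous (fun p => Z p.1 p.2)}.
  apply: (@continuous_within_weight _ z (- k) t0
    (fun p : R * R => C0 + 0 * p.2 + e * p.2 ^+ 2 + (2 * e) * (p.1 - t0))) => // p.
  rewrite (_ : (fun _ => _) = (fun p : R * R => C0 + e * (p.2 * p.2) + (2 * e) * (p.1 - t0))); last first.
    by apply/funext => q; ring.
  have c2 : {for p, continuous (snd : R * R -> R)} by exact: cvg_snd.
  apply: cvgD.
    apply: cvgD; first exact: cvg_cst.
    by apply: cvgM; [exact: cvg_cst|exact: cvgM].
  apply: cvgM; first exact: cvg_cst.
  by apply: cvgB; [exact: cvg_fst|exact: cvg_cst].
apply: (@comparison_interval Z t0 t1 0 X 0) => //; first by lra.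
- by apply: continuous_subspaceW cw => p [_ /= /andP[]].
- move=> y /andP[y0 _]; rewrite /Z /w subrr mulr0 expR0 mul1r mulr0 addr0.
  have := z0 y y0; have := sqr_ge0 y; nra.
- move=> s sI; have h1 : 0 <= e * (s - t0) by rewrite mulr_ge0//; lra.
  split; rewrite /Z.
    have : 0 <= w s 0 by rewrite mulr_ge0 ?expR_ge0// zb.
    have := sqr_ge0 (0 : R); nra.
  by have := wC s X sI ltac:(lra); nra.
- move=> s y sI /andP[y0 yX] Zsy; rewrite mul0r.
  have h1 : 0 <= e * (s - t0) by rewrite mulr_ge0//; lra.
  have wsy : w s y < 0 by move: Zsy; rewrite /Z; have := sqr_ge0 y; nra.
  have zsy : z s y < 0 by rewrite wz pmulr_rlt0 ?expR_gt0.
  have hh := heat_ge_weight (- k) t0 (zi s y sI y0 zsy).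
  apply: heat_ge_le (heat_ge_add hh (heat_ge_poly C0 0 e (2 * e) s y t0)) _.
  by rewrite le_eqVlt; apply/orP; left; apply/eqP; ring.
- by lra.
Qed.

(** An ancient bounded function which decays backward in time wherever it is negative
cannot be negative: start the forward estimate at [t0] and let [t0] tend to -oo. *)
Lemma ancient_nonneg (X : Type) (z : R -> X -> R) (C T mu : R) : 0 <= C -> 0 < mu ->
  (forall t0 t p, t0 <= t <= T -> - C * expR (- mu * (t - t0)) <= z t p) ->
  ((forall p, 0 <= z T p) -> forall t p, T <= t -> 0 <= z t p) ->
  forall t p, 0 <= z t p.
Proof.
move=> C0 mu0 h1 h2.
have h3 t p : t <= T -> 0 <= z t p.
  move=> tT; rewrite leNgt; apply/negP => ztp.
  pose s := C / (mu * - z t p).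
  have s0 : 0 <= s by apply: divr_ge0 => //; apply: mulr_ge0; lra.
  have := h1 (t - s) t p ltac:(lra).
  rewrite (_ : - mu * (t - (t - s)) = - (mu * s)); last by ring.
  have es := expR_ge1Dx (mu * s).
  have ep := expR_gt0 (mu * s).
  rewrite expRN leNgt => /negP; apply; rewrite mulNr ltrNr ltr_pdivrMr//.
  have : s * (mu * - z t p) = C.
    by rewrite /s mulfVK// gt_eqF// mulr_gt0//; lra.
  nra.
move=> t p; case: (leP t T) => [/h3//|/ltW Tt]; apply: h2 => // q; exact: h3.
Qed.

End Comparison.

(** * Comparison on the whole graph *)

Section OneSided.
Context {R : realType}.

Lemma right_slope_ge (g : R -> R) (x d m : R) :
  (g y - g x) / (y - x) @[y --> x^'+] --> d ->
  (\forall y \near x^'+, m * (y - x) <= g y - g x) -> m <= d.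
Proof.
move=> h hm; apply: (cvgr_to_ge h); near=> y.
have xy : 0 < y - x by rewrite subr_gt0; near: y; exact: nbhs_right_gt.
by rewrite ler_pdivlMr//; near: y.
Unshelve. all: by end_near. Qed.

Lemma left_slope_le (g : R -> R) (x d m : R) :
  (g y - g x) / (y - x) @[y --> x^'-] --> d ->
  (\forall y \near x^'-, m * (x - y) <= g y - g x) -> d <= - m.
Proof.
move=> h hm; apply: (cvgr_to_le h); near=> y.
have xy : y - x < 0 by rewrite subr_lt0; near: y; exact: nbhs_left_lt.
by rewrite ler_ndivrMr// mulNr -mulrN opprB; near: y.
Unshelve. all: by end_near. Qed.

Lemma within_finer (T : Type) (F H : set_system T) (A : set T) : Filter F ->
  F `=>` H -> F A -> F `=>` within A H.
Proof.
move=> FF FH FA B hB; have := FH _ hB.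
by move: FA; apply: filterS2 => y ? ; apply.
Qed.

End OneSided.

Section GraphPoints.
Context {R : realType} {N : nat} (G : mgraph R N).
Implicit Types (e : gedge G) (w : gpoint G -> R).

Lemma gpt_src (k : cedge G) : gpt (inl k : gedge G) 0 = Vtx (csrc k).
Proof. by rewrite /gpt insubN ?lexx//= ltxx. Qed.

Lemma gpt_tgt (k : cedge G) : gpt (inl k : gedge G) (clen k) = Vtx (ctgt k).
Proof. by rewrite /gpt insubN ?leNgt ?clen_gt0//= ltxx andbF. Qed.

Lemma gpt_attach (i : 'I_N) : gpt (inr i : gedge G) 0 = Vtx (attach G i).
Proof. by rewrite /gpt insubN//= ltxx. Qed.

Lemma gpt_Inner e (y : {x : R | edge_int e x}) : gpt e (val y) = Inner y.
Proof. by rewrite /gpt valK. Qed.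

Lemma gpt_int e x (h : edge_int e x) : gpt e x = Inner (Sub x h : {x : R | edge_int e x}).
Proof. by rewrite -gpt_Inner SubK. Qed.

Lemma edge_int_dom e x : edge_int e x -> edge_dom e x.
Proof. by case: e => [k|i] /=; [move=> /andP[? ?]; apply/andP; split; exact: ltW|exact: ltW]. Qed.

Lemma edge_int_near e x : edge_int e x -> \forall y \near x, edge_int e y.
Proof. by case: e => [k|i] /=; [exact: near_between|exact: near_above]. Qed.

(** Connectedness of the center and the presence of an outer path leave no isolated
vertex. *)
Lemma vertex_incident (V : vertex G) : (0 < N)%N ->
  [\/ exists k, csrc k = V, exists k : cedge G, ctgt k = V | exists i, attach G i = V].
Proof.
move=> N0; have := center_connected V (attach G (Ordinal N0)).
move=> /connectP[[|W p] /=]; first by move=> _ E; constructor 3; exists (Ordinal N0).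
move=> /andP[/existsP[k /orP[/andP[/eqP E _]|/andP[_ /eqP E]]] _] _.
  by constructor 1; exists k.
by constructor 2; exists k.
Qed.

Lemma gpt_surj (p : gpoint G) : (0 < N)%N -> exists e x, edge_dom e x /\ gpt e x = p.
Proof.
move=> N0; case: p => [V|e y].
  case: (vertex_incident V N0) => [[k <-]|[k <-]|[i <-]].
  - by exists (inl k), 0; rewrite gpt_src /= lexx ltW// clen_gt0.
  - by exists (inl k), (clen k); rewrite gpt_tgt /= lexx ltW// clen_gt0.
  - by exists (inr i), 0; rewrite gpt_attach /=.
by exists e, (val y); rewrite gpt_Inner; split => //; apply: edge_int_dom; exact: valP.
Qed.

Lemma interior_quot e w x d : edge_int e x ->
  (w (gpt e y) - w (gpt e x)) / (y - x) @[y --> within (edge_dom e) x^'] --> d ->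
  is_derive x 1 (fun y => w (gpt e y)) d.
Proof.
move=> ex h; apply: cvg_quot_is_derive; apply: cvg_trans h; apply: cvg_app.
apply: within_finer => //; apply: nbhs_dnbhs.
by have := edge_int_near ex; apply: filterS => y; exact: edge_int_dom.
Qed.

Lemma origin_quot e w (d : R) :
  (w (gpt e y) - w (gpt e 0)) / (y - 0) @[y --> within (edge_dom e) (0 : R)^'] --> d ->
  (w (gpt e y) - w (gpt e 0)) / (y - 0) @[y --> (0 : R)^'+] --> d.
Proof.
move=> h; apply: cvg_trans h; apply: cvg_app; apply: within_finer.
  exact: dnbhs_at_right.
case: e => [k|i]; near=> y => /=; last by near: y; exact: nbhs_right_ge.
apply/andP; split; near: y; first exact: nbhs_right_ge.
by apply: nbhs_right_le; exact: clen_gt0.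
Unshelve. all: by end_near. Qed.

Lemma end_quot (k : cedge G) w (d : R) (e := inl k : gedge G) (L := clen k) :
  (w (gpt e y) - w (gpt e L)) / (y - L) @[y --> within (edge_dom e) L^'] --> d ->
  (w (gpt e y) - w (gpt e L)) / (y - L) @[y --> L^'-] --> d.
Proof.
move=> h; apply: cvg_trans h; apply: cvg_app; apply: within_finer.
  exact: dnbhs_at_left.
near=> y => /=; apply/andP; split; near: y; last exact: nbhs_left_le.
by apply: nbhs_left_ge; exact: clen_gt0.
Unshelve. all: by end_near. Qed.

End GraphPoints.

Section Slopes.
Context {R : realType}.
Implicit Types x y z L : R.

Lemma parabola_near_0 L y : 0 < y -> y <= L / 2 -> L / 2 * y <= L * y - y ^+ 2.
Proof.
move=> y0 yL; have : 0 <= (L / 2 - y) * y by apply: mulr_ge0; lra.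
lra.
Qed.

Lemma parabola_near_L L y : L / 2 <= y -> y <= L ->
  L / 2 * (L - y) <= L * y - y ^+ 2.
Proof.
move=> y0 yL; have : 0 <= (y - L / 2) * (L - y) by apply: mulr_ge0; lra.
lra.
Qed.

Lemma sum3_gt0 x y z : 0 <= x -> 0 <= y -> 0 <= z ->
  [\/ 0 < x, 0 < y | 0 < z] -> 0 < x + y + z.
Proof. by move=> x0 y0 z0 []; lra. Qed.

End Slopes.

Section GraphComparison.
Context {R : realType} {N : nat} (G : mgraph R N).

(** Minus the inward slope of [x^2 - tilt e * x] at the endpoints of [e]; this parabola
vanishes at every vertex, so that it is continuous on the graph. *)
Definition tilt (e : gedge G) : R := match e with inl k => clen k | inr _ => 1 end.

Lemma tilt_gt0 e : 0 < tilt e.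
Proof. by case: e => [k|i] //=; exact: clen_gt0. Qed.

(** A negative minimum in the interior of an edge is excluded as on an interval. At a
vertex all inward slopes would be nonnegative, which the Kirchhoff condition alone allows
when they vanish. Adding [eps (x^2 - tilt e * x)] on each edge makes the Kirchhoff sum
negative and excludes this case as well; it takes the place of the Hopf lemma. On the outer
edges the same term dominates [z] far away. *)
Lemma comparison_graph (z : R -> gpoint G -> R) (D : R -> gedge G -> R -> R)
    (t0 t1 k C C0 : R) : (0 < N)%N -> 0 <= C0 ->
  (forall e : gedge G, {within [set p : R * R | edge_dom e p.2],
     continuous (fun p : R * R => z p.1 (gpt e p.2))}) ->
  (forall t (e : gedge G) x, edge_dom e x ->
     (z t (gpt e y) - z t (gpt e x)) / (y - x) @[y --> within (edge_dom e) x^'] --> D t e x) ->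
  (forall t V,
     \sum_(b : cedge G | csrc b == V) thickness G (inl b) * D t (inl b) 0
     + \sum_(b : cedge G | ctgt b == V) thickness G (inl b) * (- D t (inl b) (clen b))
     + \sum_(i < N | attach G i == V) thickness G (inr i) * D t (inr i) 0 = 0) ->
  (forall t p, t0 <= t <= t1 -> - C <= z t p) ->
  (forall p, - C0 <= z t0 p) ->
  (forall t (e : gedge G) x, t0 < t <= t1 -> edge_int e x -> z t (gpt e x) < 0 ->
     heat_ge (fun t x => z t (gpt e x)) t x (k * z t (gpt e x))) ->
  forall t p, t0 <= t <= t1 -> - C0 * expR (k * (t - t0)) <= z t p.
Proof.
move=> N0 C00 cz zD zK zC z0 zi t p tt; rewrite leNgt; apply/negP => ztp.
have [ep [xp [xpI Ep]]] := gpt_surj p N0.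
pose w t q := expR ((- k) * (t - t0)) * z t q.
have wz s q : z s q = expR (k * (s - t0)) * w s q.
  by rewrite /w mulrA -expRD mulNr subrr expR0 mul1r.
have wlt : w t p < - C0.
  by move: ztp; rewrite wz [ltRHS]mulrC ltr_pM2l ?expR_gt0.
have t01 : t0 <= t1 by lra.
(* the constant K makes K + x^2 - tilt e * x at least 1 on every edge *)
pose K := 1 + \sum_(e : gedge G) tilt e ^+ 2.
have K1 e x : 1 <= K + x ^+ 2 - tilt e * x.
  have : tilt e ^+ 2 <= \sum_(e : gedge G) tilt e ^+ 2.
    rewrite (bigD1 e)//= lerDl; apply: sumr_ge0 => e' _; exact: sqr_ge0.
  rewrite /K; have := sqr_ge0 (tilt e / 2 - x); have := sqr_ge0 (tilt e); nra.
pose B := K + xp ^+ 2 - tilt ep * xp + 3 * (t - t0).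
have B1 : 1 <= B by rewrite /B; have := K1 ep xp; lra.
(* so small that the perturbed function Z is still negative at (t, p) *)
have [eps [eps0 epsE]] : exists eps, 0 < eps /\ eps * (2 * B) = - C0 - w t p.
  exists ((- C0 - w t p) / (2 * B)); split; first by rewrite divr_gt0//; lra.
  by rewrite mulfVK//; lra.
pose Z (e : gedge G) t x := w t (gpt e x) +
  ((C0 + eps * K) + (- (eps * tilt e)) * x + eps * x ^+ 2 + (3 * eps) * (t - t0)).
have Ztp : Z ep t xp < 0.
  have : eps * B = eps * K + eps * xp ^+ 2 - eps * tilt ep * xp + 3 * eps * (t - t0).
    by rewrite /B; ring.
  by rewrite /Z Ep; lra.
have Zw e s x : t0 <= s -> w s (gpt e x) + C0 + eps <= Z e s x.
  move=> ts; have := K1 e x; rewrite /Z => h.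
  have := ler_wpM2l (ltW eps0) h.
  have : 0 <= eps * (s - t0) by rewrite mulr_ge0 ?subr_ge0// ltW.
  lra.
have Zneg e s x : t0 <= s -> Z e s x < 0 -> z s (gpt e x) < 0.
  move=> ts h; have := Zw e s x ts; rewrite wz pmulr_rlt0 ?expR_gt0//; lra.
pose E := expR (`|k| * (t1 - t0)).
have wC s q : t0 <= s <= t1 -> - (`|C| * E) <= w s q.
  move=> sI; rewrite /w lerNl -mulrN.
  have h1 : - z s q <= `|C| by have := zC s q sI; have := ler_norm C; lra.
  have h2 : expR (- k * (s - t0)) <= E.
    rewrite /E ler_expR; have : - k <= `|k| by rewrite -normrN ler_norm.
    have : 0 <= `|k| by []. nra.
  have h3 := expR_ge0 (- k * (s - t0)).
  have h4 : 0 <= `|C| by []. nra.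
pose h := `|C| * E / eps.
have h0 : 0 <= h.
  by apply: divr_ge0; [apply: mulr_ge0 => //; exact: expR_ge0|exact: ltW].
(* at X the quadratic term outweighs the lower bound - eps h of w *)
pose X := `|xp| + 2 + h.
have X0 : 2 <= X by rewrite /X; have := normr_ge0 xp; lra.
have ZX (i : 'I_N) s : t0 <= s <= t1 -> 0 < Z (inr i) s X.
  move=> sI; have := wC s (gpt (inr i : gedge G) X) sI.
  have -> : `|C| * E = eps * h by rewrite /h [RHS]mulrC mulfVK// gt_eqF.
  have K0 : 1 <= K by rewrite /K lerDl; apply: sumr_ge0 => e' _; exact: sqr_ge0.
  have : eps * h < eps * (K + X ^+ 2 - X).
    rewrite ltr_pM2l//; have : 2 * X <= X ^+ 2 by rewrite expr2 ler_wpM2r//; lra.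
    by rewrite /X; have := normr_ge0 xp; lra.
  have : 0 <= eps * (s - t0) by apply: mulr_ge0; [exact: ltW|lra].
  rewrite /Z /=; nra.
pose len (e : gedge G) := match e with inl b => clen b | inr _ => X end.
have len0 e : 0 < len e by case: e => [b|i] /=; [exact: clen_gt0|lra].
have len_dom e x : 0 <= x <= len e -> edge_dom e x.
  by case: e => [b|i] //= /andP[].
have xpl : 0 <= xp <= len ep.
  have xX : xp <= X by rewrite /X; have := ler_norm xp; lra.
  by move: xpI {Ep Ztp}; rewrite /len; case: (ep) => [b|i] //= ->.
have cZ e : {within rect t0 t1 0 (len e), continuous (fun q => Z e q.1 q.2)}.
  apply: (@continuous_within_weight _ _ (fun t x => z t (gpt e x)) (- k) t0
    (fun q : R * R => (C0 + eps * K) + (- (eps * tilt e)) * q.2 + eps * q.2 ^+ 2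
       + (3 * eps) * (q.1 - t0))).
    by apply: continuous_subspaceW (cz e) => q [_ hq]; exact: len_dom.
  move=> q.
  rewrite (_ : (fun _ => _) = (fun q : R * R => (C0 + eps * K) + (- (eps * tilt e)) * q.2
     + eps * (q.2 * q.2) + (3 * eps) * (q.1 - t0))); last first.
    by apply/funext => ?; ring.
  have c2 : {for q, continuous (snd : R * R -> R)} by exact: cvg_snd.
  apply: cvgD.
    apply: cvgD.
      apply: cvgD; first exact: cvg_cst.
      by apply: cvgM; [exact: cvg_cst|exact: c2].
    by apply: cvgM; [exact: cvg_cst|exact: cvgM].
  apply: cvgM; first exact: cvg_cst.
  by apply: cvgB; [exact: cvg_fst|exact: cvg_cst].
have hmin e : exists c, rect t0 t1 0 (len e) c /\
    forall q, rect t0 t1 0 (len e) q -> Z e c.1 c.2 <= Z e q.1 q.2.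
  by have [c h1 h2] := rect_min t01 (ltW (len0 e)) (cZ e); exists c.
have [c hc] := choice hmin.
have [e _ he] := @arg_minP _ _ _ ep xpredT (fun e => Z e (c e).1 (c e).2) isT.
have {hc he} [s [y [sI yI Zs hm]]] : exists s y, [/\ t0 <= s <= t1, 0 <= y <= len e,
    Z e s y < 0 & forall e' s' y', t0 <= s' <= t1 -> 0 <= y' <= len e' ->
      Z e s y <= Z e' s' y'].
  exists (c e).1, (c e).2; have [[hc1 hc2] hc3] := hc e; split => //.
    apply: le_lt_trans Ztp; apply: le_trans (he ep isT) _.
    by have [_ hh] := hc ep; apply: (hh (t, xp)); split.
  move=> e' s' y' h1 h2; apply: le_trans (he e' isT) _.
  by have [_ hh] := hc e'; apply: (hh (s', y')); split.
have zs := Zneg e s y ltac:(lra) Zs.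
have s0 : t0 < s.
  rewrite lt_neqAle; apply/andP; split; last by lra.
  apply/eqP => Es; have := Zw e s y ltac:(lra); have := z0 (gpt e y).
  by rewrite /w -Es subrr mulr0 expR0 mul1r Es; lra.
(* the value of Z at an endpoint depends on the vertex only *)
pose zV V := w s (Vtx V) + C0 + eps * K + 3 * eps * (s - t0).
have : exists V, forall e' y', 0 <= y' <= len e' -> zV V <= Z e' s y'.
  have [yint|] := boolP (edge_int e y && (y < len e)).
    move/andP: yint => [yint ylt].
    have hh := heat_ge_weight (- k) t0 (zi s e y ltac:(lra) yint zs).
    have hZ : heat_ge (Z e) s y eps.
      apply: heat_ge_le (heat_ge_add hh
        (heat_ge_poly (C0 + eps * K) (- (eps * tilt e)) eps (3 * eps) s y t0)) _.
      by rewrite le_eqVlt; apply/orP; left; apply/eqP; ring.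
    exfalso; apply: (no_interior_min s0 eps0 hZ) => [s' s'I|].
      by apply: hm => //; lra.
    have y0 : 0 < y by case: (e) yint => [b|i] //= /andP[].
    have : \forall y' \near y, 0 < y' < len e by apply: near_between; rewrite y0.
    by apply: filterS => y' yI'; apply: hm => //; lra.
  move=> yend.
  have [V [EV1 EV2]] : exists V, gpt e y = Vtx V /\ y ^+ 2 - tilt e * y = 0.
    move: yI Zs yend {zs hm}; case: e => [b|i] /=.
      move=> yI _ yend; have [->|yn0] := eqVneq y 0.
        by exists (csrc b); rewrite gpt_src; split => //; ring.
      have [->|ynL] := eqVneq y (clen b).
        by exists (ctgt b); rewrite gpt_tgt; split => //; ring.
      by move: yend; rewrite !lt_neqAle eq_sym yn0 ynL; case/andP: yI => -> ->.
    move=> yI Zs yend; have [->|yn0] := eqVneq y 0.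
      by exists (attach G i); rewrite gpt_attach; split => //; ring.
    have yX : y = X.
      by apply/eqP; move: yend; rewrite !lt_neqAle eq_sym yn0; case/andP: yI => -> ->; rewrite /= andbT negbK.
    by move: Zs; rewrite yX => Zs; have := ZX i s sI; rewrite ltNge ltW.
  exists V => e' y' yI'; have := hm e' s y' sI yI'.
  suff -> : zV V = Z e s y by [].
  rewrite /zV /Z EV1; have : eps * (y ^+ 2 - tilt e * y) = 0 by rewrite EV2 mulr0.
  lra.
move=> [V hV].
(* the increments of z from V inherit a lower bound from the minimality of zV V *)
have sl e' y' v : 0 <= y' <= len e' -> gpt e' v = Vtx V ->
    expR (k * (s - t0)) * (eps * (tilt e' * y' - y' ^+ 2)) <= z s (gpt e' y') - z s (gpt e' v).
  move=> yI' Ev; rewrite Ev !wz -mulrBr ler_wpM2l ?expR_ge0//.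
  by have := hV e' y' yI'; rewrite /zV /Z; lra.
have Ek := expR_gt0 (k * (s - t0)).
have slope0 e' : gpt e' 0 = Vtx V -> 0 < D s e' 0.
  move=> E0; have d0 : edge_dom e' 0 by apply: len_dom; rewrite lexx ltW.
  have hD := origin_quot (zD s e' 0 d0).
  apply: (@lt_le_trans _ _ (expR (k * (s - t0)) * eps * (tilt e' / 2))).
    by apply: mulr_gt0; [exact: mulr_gt0|rewrite divr_gt0// tilt_gt0].
  apply: (right_slope_ge hD); near=> y'.
  have y'0 : 0 < y' by near: y'; exact: nbhs_right_gt.
  have y'l : y' <= len e' by near: y'; exact: nbhs_right_le.
  have y't : y' <= tilt e' / 2.
    by near: y'; apply: nbhs_right_le; have := tilt_gt0 e'; lra.
  apply: le_trans (sl e' y' 0 _ E0); last by rewrite ltW.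
  rewrite subr0 -!mulrA ler_pM2l// ler_pM2l//.
  by rewrite !mulrA; exact: parabola_near_0.
have slopeL (b : cedge G) : ctgt b = V -> D s (inl b) (clen b) < 0.
  move=> EV; have EL : gpt (inl b : gedge G) (clen b) = Vtx V by rewrite gpt_tgt EV.
  have dL : edge_dom (inl b : gedge G) (clen b) by rewrite /= lexx ltW// clen_gt0.
  have L0 := clen_gt0 b.
  have hD := end_quot (zD s (inl b) (clen b) dL).
  apply: (@le_lt_trans _ _ (- (expR (k * (s - t0)) * eps * (clen b / 2)))); last first.
    by rewrite oppr_lt0; apply: mulr_gt0; [exact: mulr_gt0|lra].
  apply: (left_slope_le hD); near=> y'.
  have y'0 : clen b / 2 <= y' by near: y'; apply: nbhs_left_ge; lra.
  have y'l : y' <= clen b by near: y'; exact: nbhs_left_le.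
  apply: le_trans (sl (inl b) y' (clen b) _ EL); last by rewrite /= y'l andbT; lra.
  rewrite -!mulrA ler_pM2l// ler_pM2l//=.
  by rewrite !mulrA; exact: parabola_near_L.
have tp e' := thickness_gt0 e' : 0 < thickness G e'.
have := zK s V.
set S1 := (X in X + _ + _); set S2 := (X in _ + X + _); set S3 := (X in _ + _ + X).
have P1 b : csrc b == V -> 0 < thickness G (inl b) * D s (inl b) 0.
  by move=> /eqP EV; rewrite mulr_gt0// slope0// gpt_src EV.
have P2 b : ctgt b == V -> 0 < thickness G (inl b) * - D s (inl b) (clen b).
  by move=> /eqP EV; rewrite mulr_gt0// oppr_gt0 slopeL.
have P3 i : attach G i == V -> 0 < thickness G (inr i) * D s (inr i) 0.
  by move=> /eqP EV; rewrite mulr_gt0// slope0// gpt_attach EV.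
have S10 : 0 <= S1 by apply: sumr_ge0 => b hb; exact: ltW (P1 b hb).
have S20 : 0 <= S2 by apply: sumr_ge0 => b hb; exact: ltW (P2 b hb).
have S30 : 0 <= S3 by apply: sumr_ge0 => b hb; exact: ltW (P3 b hb).
move=> S0; suff h3 : [\/ 0 < S1, 0 < S2 | 0 < S3].
  by have := sum3_gt0 S10 S20 S30 h3; rewrite S0 ltxx.
case: (vertex_incident V N0) => [[b EV]|[b EV]|[i EV]].
- constructor 1; rewrite /S1 (bigD1 b) ?EV//=.
  apply: ltr_pwDl; first by apply: P1; rewrite EV.
  by apply: sumr_ge0 => b' /andP[hb _]; exact: ltW (P1 b' hb).
- constructor 2; rewrite /S2 (bigD1 b) ?EV//=.
  apply: ltr_pwDl; first by apply: P2; rewrite EV.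
  by apply: sumr_ge0 => b' /andP[hb _]; exact: ltW (P2 b' hb).
- constructor 3; rewrite /S3 (bigD1 i) ?EV//=.
  apply: ltr_pwDl; first by apply: P3; rewrite EV.
  by apply: sumr_ge0 => b' /andP[hb _]; exact: ltW (P3 b' hb).
Unshelve. all: by end_near. Qed.

End GraphComparison.

(** * Antiderivatives *)

Section Antiderivative.
Context {R : realType}.
Implicit Types g P : R -> R.

Lemma integral_is_derive g (a x : R) : continuous g -> a < x ->
  is_derive x 1 (fun y => \int[@lebesgue_measure R]_(t in `[a, y]) g t)%R (g x).
Proof.
move=> cg ax.
have ig : (@lebesgue_measure R).-integrable `[a, x + 1] (EFin \o g).
  apply: continuous_compact_integrable; first exact: segment_compact.
  exact: continuous_subspaceT.
have x1 : x < x + 1 by rewrite ltrDl.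
have [h1 h2] := @continuous_FTC1_closed R g a x (x + 1) x1 ig ax (cg x).
by split; [exact: h1|rewrite -derive1E; exact: h2].
Qed.

Lemma is_derive0_const P (a b : R) : a <= b ->
  (forall x, a <= x <= b -> is_derive x 1 P 0) -> P a = P b.
Proof.
move=> ab hP.
have cP : {within `[a, b], continuous P}.
  by apply: derivable_within_continuous => x /[!in_itv]/= xI; have [] := hP x xI.
have hP' x : x \in `]a, b[ -> is_derive x 1 P 0.
  by rewrite in_itv/= => /andP[? ?]; apply: hP; rewrite !ltW.
have [c _] := MVT_segment ab hP' cP.
by rewrite mul0r => /eqP; rewrite subr_eq0 => /eqP.
Qed.

Lemma is_derive_near_eq P Q (x d : R) : is_derive x 1 P d ->
  (\forall y \near x, P y = Q y) -> is_derive x 1 Q d.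
Proof.
move=> /is_derive_cvg_quot h e; apply: cvg_quot_is_derive; apply: cvg_trans h.
apply: near_eq_cvg; have ex := nbhs_singleton e.
by have := nbhs_dnbhs e; apply: filterS => y ey; rewrite ex ey.
Qed.

(** The integrals of [g] and of its reflection from -1 are antiderivatives on
half-lines which overlap around 0, where they can be glued. *)
Lemma antiderivative_exists g : continuous g ->
  exists P : R -> R, P 0 = 0 /\ forall x : R, is_derive x 1 P (g x).
Proof.
move=> cg; pose g' y := g (- y).
have cg' : continuous g'.
  move=> y; apply: (@continuous_comp _ _ _ -%R g); [exact: opp_continuous|exact: cg].
pose A (y : R) : R := (\int[@lebesgue_measure R]_(t in `[-1, y]) g t)%R.
pose B (y : R) : R := (\int[@lebesgue_measure R]_(t in `[-1, y]) g' t)%R.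
have hA (x : R) : -1 < x -> is_derive x 1 A (g x) by move=> ?; exact: integral_is_derive.
have hB (x : R) : x < 1 -> is_derive x 1 (fun y => B (- y)) (- g x).
  move=> x1; have hb : is_derive (- x) 1 B (g' (- x)).
    by apply: integral_is_derive => //; lra.
  have hN := is_derive_fun_opp (is_derive_fun_id x).
  by apply: is_derive_eq (is_derive_fun_comp hb hN) _; rewrite /g' opprK; ring.
pose P (x : R) : R := if 0 <= x then A x - A 0 else B 0 - B (- x).
have PA x : -1 < x -> P x = A x - A 0.
  move=> x1; rewrite /P; case: (leP 0 x) => // x0.
  have h (y : R) : x <= y <= 0 -> is_derive y 1 (fun y => A y + B (- y)) 0.
    move=> /andP[xy y0].
    have h1 := hA y ltac:(lra). have h2 := hB y ltac:(lra).
    by apply: is_derive_eq (is_derive_fun_add h1 h2) _; rewrite subrr.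
  have := is_derive0_const (ltW x0) h; rewrite oppr0; lra.
exists P; split; first by rewrite PA ?subrr//; lra.
move=> x; case: (ltP (-1) x) => [x1|x1].
  have h := is_derive_fun_sub (hA x x1) (is_derive_fun_cst x (A 0)).
  rewrite subr0 in h; apply: is_derive_near_eq h _.
  by have := near_above x1; apply: filterS => y y1; rewrite PA.
have h := is_derive_fun_sub (is_derive_fun_cst x (B 0)) (hB x ltac:(lra)).
rewrite sub0r opprK in h; apply: is_derive_near_eq h _.
have : \forall y \near x, x - 1 < y < 0 by apply: near_between; lra.
by apply: filterS => y /andP[_ y0]; rewrite /P leNgt y0.
Qed.

Lemma primitive_antiderivative g P (s : R) : continuous g -> P 0 = 0 ->
  (forall x : R, is_derive x 1 P (g x)) -> 0 < s -> primitive g s = P s.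
Proof.
move=> cg P0 hP s0; rewrite /primitive /Rintegral.
have cP : continuous P by move=> x; exact: is_derive_continuous (hP x).
rewrite (@continuous_FTC2 R g P 0 s s0) ?P0 ?sube0//.
- exact: continuous_subspaceT.
- split; first by move=> x _; have [] := hP x.
  + by apply: cvg_at_right_filter; exact: cP.
  + by apply: cvg_at_left_filter; exact: cP.
- by move=> x _; rewrite derive1E; have [] := hP x.
Qed.

End Antiderivative.

(** * Solutions on a half-line: convergence to a steady state *)

Section HalfLine.
Context {R : realType}.
Implicit Types (f : R -> R) (U Y : R -> R -> R).

Definition heat_eq Y (t x m : R) := exists yt yxx : R,
  [/\ is_derive t 1 (fun s => Y s x) yt, has_d2 (Y t) x yxx & yt - yxx = m].

Lemma heat_eq_opp Y t x m : heat_eq Y t x m -> heat_eq (fun t x => - Y t x) t x (- m).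
Proof.
move=> [yt [yxx [h1 h2 h3]]]; exists (- yt), (- yxx); split; last by lra.
  exact: is_derive_fun_opp.
have := has_d2_scale (-1) h2; rewrite mulN1r.
by under eq_fun do rewrite mulN1r.
Qed.

Lemma heat_eq_sub_ge Y Z t x (m n : R) : heat_ge Z t x m -> heat_eq Y t x n ->
  heat_ge (fun t x => Z t x - Y t x) t x (m - n).
Proof.
move=> [zt [zxx [h1 h2 h3]]] [yt [yxx [h4 h5 h6]]].
exists (zt - yt), (zxx - yxx); split; [exact: is_derive_fun_sub|exact: has_d2_sub|lra].
Qed.

Lemma heat_eq_shift Y t x (a m : R) : heat_eq Y t (a + x) m ->
  heat_eq (fun t x => Y t (a + x)) t x m.
Proof.
move=> [yt [yxx [h1 h2 h3]]]; exists yt, yxx; split => //; exact: has_d2_shift.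
Qed.

Lemma within_continuous_comp (S T : topologicalType) (A : set T) (B : set S)
    (g : T -> R) (h : S -> T) : {within A, continuous g} -> continuous h ->
  (forall p, B p -> A (h p)) -> {within B, continuous (fun p => g (h p))}.
Proof.
move=> /subspace_continuousP hg ch hBA; apply/subspace_continuousP => p Bp.
apply: cvg_trans (hg _ (hBA _ Bp)) => O hO.
have := ch p _ hO; rewrite /nbhs /= /within /=; apply: filterS => q hq Bq.
exact: hq (hBA _ Bq).
Qed.

Lemma continuous_expR_poly (k t0 A B C A' B' C' : R) : continuous (fun p : R * R =>
  expR (k * (p.1 - t0)) * (A + B * p.2 + C * p.2 ^+ 2) + (A' + B' * p.2 + C' * p.2 ^+ 2)).
Proof.
have cp (a b c : R) : continuous (fun p : R * R => a + b * p.2 + c * p.2 ^+ 2).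
  move=> p; rewrite (_ : (fun _ => _) = (fun p : R * R => a + b * p.2 + c * (p.2 * p.2))); last first.
    by apply/funext => q; ring.
  have c2 : {for p, continuous (snd : R * R -> R)} by exact: cvg_snd.
  apply: cvgD; first by apply: cvgD; [exact: cvg_cst|apply: cvgM; [exact: cvg_cst|exact: c2]].
  by apply: cvgM; [exact: cvg_cst|exact: cvgM].
move=> p; apply: cvgD; last exact: cp.
apply: cvgM; last exact: cp.
apply: (@continuous_comp _ _ _ (fun p : R * R => k * (p.1 - t0)) expR); last exact: continuous_expR.
apply: cvgM; first exact: cvg_cst.
by apply: cvgB; [exact: cvg_fst|exact: cvg_cst].
Qed.

(** A subsolution of the heat equation with a source at most [M] on [[0, L]] is bounded
by the steady state with source [M] and the same boundary values, up to a transient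
decaying at the rate [L^-2]. *)
Lemma barrier_interval Y (T L p q M C : R) : 0 < L -> 0 <= M -> 0 <= C ->
  {within [set p : R * R | 0 <= p.2], continuous (fun p => Y p.1 p.2)} ->
  (forall t, T <= t -> Y t 0 <= p /\ Y t L <= q) ->
  (forall x, 0 <= x <= L -> Y T x <= C + p /\ Y T x <= C + q) ->
  (forall t x, T < t -> 0 < x < L -> exists2 m, m <= M & heat_eq Y t x m) ->
  forall t x, T <= t -> 0 <= x <= L ->
  Y t x <= p + (q - p) / L * x + M / 2 * x * (L - x)
           + expR (- (L ^+ 2)^-1 * (t - T)) * (2 * C).
Proof.
move=> L0 M0 C0 cY Yb Y0 Yi t x Tt xI.
pose la := (L ^+ 2)^-1.
have la0 : 0 < la by rewrite invr_gt0 exprn_gt0.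
have laL : la * L ^+ 2 = 1 by rewrite mulVf// gt_eqF// exprn_gt0.
(* the transient h: its profile 2 C - C la x^2 lies between C and 2 C on the interval and
   is concave enough to decay at the rate la *)
pose h t x := expR (- la * (t - T)) * (2 * C + 0 * x + (- (C * la)) * x ^+ 2 + 0 * (t - T)).
pose g t x := p + ((q - p) / L + M / 2 * L) * x + (- (M / 2)) * x ^+ 2 + 0 * (t - T).
pose z t x := h t x + g t x - Y t x.
have xL y : 0 <= y <= L -> C <= 2 * C - C * la * y ^+ 2.
  move=> yI; have : la * y ^+ 2 <= 1 by rewrite -laL ler_pM2l// !expr2; nra.
  nra.
have gE s y : g s y = p + (q - p) / L * y + M / 2 * (y * (L - y)) by rewrite /g; ring.
have qp y : 0 <= y <= L -> p <= p + (q - p) / L * y \/ q <= p + (q - p) / L * y.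
  move=> /andP[y0 yL]; case: (leP p q) => pq.
    left; rewrite lerDl; apply: mulr_ge0 => //; apply: divr_ge0; lra.
  right; have h1 : (p - q) / L * y <= p - q.
    by rewrite mulrAC ler_pdivrMr// ler_wpM2l//; lra.
  have -> : (q - p) / L = - ((p - q) / L) by rewrite -mulNr opprB.
  lra.
have hg s y : T <= s -> 0 <= y <= L -> 0 <= h s y /\ p + (q - p) / L * y <= g s y.
  move=> Ts yI; split.
    rewrite /h; apply: mulr_ge0; first exact: expR_ge0.
    by have := xL y yI; lra.
  have h1 : 0 <= y * (L - y) by apply: mulr_ge0; lra.
  by rewrite gE lerDl; apply: mulr_ge0 => //; lra.
suff : 0 <= z t x.
  have : h t x <= expR (- la * (t - T)) * (2 * C).
    rewrite /h; apply: ler_wpM2l; first exact: expR_ge0.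
    have : 0 <= C * la * x ^+ 2 by apply: mulr_ge0; [apply: mulr_ge0 => //; exact: ltW|exact: sqr_ge0].
    by lra.
  by rewrite /z gE -/la !mulrA; lra.
have tI : T <= t <= t by rewrite Tt lexx.
apply: (@comparison_interval _ z T t 0 L 0 (ltW L0) _ _ _ _ t x tI xI).
- have cY' : {within rect T t 0 L, continuous (fun p => Y p.1 p.2)}.
    by apply: continuous_subspaceW cY => r [_ /= /andP[]].
  move=> y; apply: cvgB; last exact: cY'.
  apply: (@continuous_subspaceT _ _ _ (fun p : R * R => h p.1 p.2 + g p.1 p.2)).
  rewrite (_ : (fun _ => _) = (fun r : R * R => expR (- la * (r.1 - T)) *
      (2 * C + 0 * r.2 + (- (C * la)) * r.2 ^+ 2) +
      (p + ((q - p) / L + M / 2 * L) * r.2 + (- (M / 2)) * r.2 ^+ 2))).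
    exact: continuous_expR_poly.
  by apply/funext => r; rewrite /h /g; ring.
- move=> y yI; have [h1 h2] := Y0 y yI; have [_ h3] := hg T y (lexx _) yI.
  have : C <= h T y by rewrite /h subrr mulr0 expR0 mul1r; have := xL y yI; lra.
  by rewrite /z; case: (qp y yI); lra.
- move=> s sI; have [h1 h2] := Yb s ltac:(lra).
  have [h3 h4] := hg s 0 ltac:(lra) ltac:(lra).
  have [h5 h6] := hg s L ltac:(lra) ltac:(lra).
  rewrite /z; split; first by lra.
  have e : (q - p) / L * L = q - p by rewrite mulfVK// gt_eqF.
  by rewrite e in h6; lra.
- move=> s y sI yI _; have [m mM hm] := Yi s y ltac:(lra) yI.
  have h1 := heat_ge_weight (- la) T (heat_ge_poly (2 * C) 0 (- (C * la)) 0 s y T).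
  have h2 := heat_ge_poly p ((q - p) / L + M / 2 * L) (- (M / 2)) 0 s y T.
  apply: heat_ge_le (heat_eq_sub_ge (heat_ge_add h1 h2) hm) _.
  rewrite mul0r; have := expR_ge0 (- la * (s - T)).
  set E := expR _ => E0.
  have : 0 <= E * (la * (C * la * y ^+ 2)).
    have la0' := ltW la0.
    apply: mulr_ge0 => //; apply: mulr_ge0 => //; apply: mulr_ge0; last exact: sqr_ge0.
    exact: mulr_ge0.
  by lra.
Qed.

End HalfLine.

Section SteadyState.
Context {R : realType}.
Implicit Types (f V : R -> R) (U : R -> R -> R).

Record halfline_solution f U : Prop := {
  hs_continuous : {within [set p : R * R | 0 <= p.2], continuous (fun p => U p.1 p.2)};
  hs_equation : forall t x, 0 < x -> heat_eq U t x (f (U t x));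
  hs_range : forall t x, 0 <= x -> 0 < U t x < 1
}.

Lemma halfline_solution_shift f U (a : R) : 0 <= a -> halfline_solution f U ->
  halfline_solution f (fun t x => U t (a + x)).
Proof.
move=> a0 [hc he hr]; split.
- have hs : continuous (fun p : R * R => (p.1, a + p.2)).
    move=> p; have h1 : q.1 @[q --> p] --> p.1 by exact: cvg_fst.
    have h2 : a + q.2 @[q --> p] --> a + p.2.
      by apply: cvgD; [exact: cvg_cst|exact: cvg_snd].
    exact: cvg_pair h1 h2.
  by apply: (within_continuous_comp (B := [set p : R * R | 0 <= p.2]) hc hs) => p /= p0; lra.
- move=> t x x0; apply: heat_eq_shift; have := he t (a + x); apply; lra.
- by move=> t x x0; have := hr t (a + x); apply; lra.
Qed.

Lemma cvgy_eventually (g : R -> R) (l e : R) : g t @[t --> +oo] --> l -> 0 < e ->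
  exists T, forall t, T <= t -> `|g t - l| <= e.
Proof.
move=> /cvgrPdist_le h e0; have [T [_ hT]] := h e e0.
exists (T + 1) => t Tt; rewrite distrC.
by have := hT t ltac:(lra).
Qed.

Lemma cvgy_le (g : R -> R) (l c T : R) : g t @[t --> +oo] --> l ->
  (forall t, T <= t -> g t <= c) -> l <= c.
Proof.
move=> h hT; apply: (cvgr_to_le h); near=> t; apply: hT.
by near: t; apply: nbhs_pinfty_ge; exact: num_real.
Unshelve. all: by end_near. Qed.

Lemma cvgy_ge (g : R -> R) (l c T : R) : g t @[t --> +oo] --> l ->
  (forall t, T <= t -> c <= g t) -> c <= l.
Proof.
move=> h hT; apply: (cvgr_to_ge h); near=> t; apply: hT.
by near: t; apply: nbhs_pinfty_ge; exact: num_real.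
Unshelve. all: by end_near. Qed.

Lemma cvgy_dist (g : R -> R) (l b c T : R) : g t @[t --> +oo] --> l ->
  (forall t, T <= t -> `|g t - b| <= c) -> `|l - b| <= c.
Proof.
move=> h hT; rewrite ler_distl; apply/andP; split.
  by apply: (cvgy_ge h (T := T)) => t /hT; rewrite ler_distl => /andP[].
by apply: (cvgy_le h (T := T)) => t /hT; rewrite ler_distl => /andP[].
Qed.

Lemma transient_small (la T C e : R) : 0 < la -> 0 <= C -> 0 < e ->
  exists2 T', T <= T' & forall t, T' <= t -> expR (- la * (t - T)) * C <= e.
Proof.
move=> la0 C0 e0; exists (T + C / e / la).
  by rewrite lerDl; apply: divr_ge0; [apply: divr_ge0 => //; exact: ltW|exact: ltW].
move=> t ht; rewrite mulNr expRN [leLHS]mulrC ler_pdivrMr ?expR_gt0//.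
have h1 : C / e <= la * (t - T) by rewrite [leRHS]mulrC -ler_pdivrMr//; lra.
have h2 := expR_ge1Dx (la * (t - T)).
by rewrite [leRHS]mulrC -ler_pdivrMr//; lra.
Qed.

Section Modulus.
Variables (f : R -> R) (M : R).
Hypothesis fM : forall s, 0 <= s <= 1 -> `|f s| <= M.

Lemma source_bound_ge0 : 0 <= M.
Proof. by apply: le_trans (fM (s := 0) _); rewrite ?normr_ge0// lexx ler01. Qed.

(** Convergence of the boundary value forces the solution to be eventually close to it
near the boundary, with a linear modulus which does not depend on the solution. *)
Lemma boundary_modulus U (b e : R) : halfline_solution f U ->
  U t 0 @[t --> +oo] --> b -> 0 < e ->
  exists T, forall t x, T <= t -> 0 <= x <= 1 -> `|U t x - b| <= e + (M + 2) * x.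
Proof.
move=> [hc he hr] hb e0; have M0 := source_bound_ge0.
have b0 : 0 <= b by apply: (cvgy_ge hb (T := 0)) => t _; have := hr t 0 (lexx _); lra.
have b1 : b <= 1 by apply: (cvgy_le hb (T := 0)) => t _; have := hr t 0 (lexx _); lra.
have e20 : 0 < e / 2 by lra.
have [T hT] := cvgy_eventually hb e20.
have l10 : 0 < (1 ^+ 2)^-1 :> R by rewrite expr1n invr1.
have [T' TT' hT'] := @transient_small (1 ^+ 2)^-1 T (2 * 1) (e / 2) l10 ltac:(lra) ltac:(lra).
exists T' => t x tT' xI.
have hx : 0 <= M * (x * x) by apply: mulr_ge0 => //; apply: mulr_ge0; lra.
have hMx : 0 <= M * x by apply: mulr_ge0; lra.
have hup : U t x <= b + e / 2 + (1 - (b + e / 2)) / 1 * x + M / 2 * x * (1 - x)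
    + expR (- (1 ^+ 2)^-1 * (t - T)) * (2 * 1).
  apply: (barrier_interval (Y := U)) => //; last lra.
  - by move=> s sT; have := hT s sT; rewrite ler_distl; have := hr s 1 ler01; lra.
  - by move=> y yI; have := hr T y ltac:(lra); lra.
  - move=> s y sT yI; exists (f (U s y)); last by apply: he; lra.
    by apply: le_trans (ler_norm _) (fM _); have := hr s y ltac:(lra); lra.
have hlo : - U t x <= - b + e / 2 + (0 - (- b + e / 2)) / 1 * x + M / 2 * x * (1 - x)
    + expR (- (1 ^+ 2)^-1 * (t - T)) * (2 * 1).
  apply: (barrier_interval (Y := fun t x => - U t x)) => //; last lra.
  - move=> p; apply: cvgN; exact: hc.
  - by move=> s sT; have := hT s sT; rewrite ler_distl; have := hr s 1 ler01; lra.
  - by move=> y yI; have := hr T y ltac:(lra); lra.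
  - move=> s y sT yI; exists (- f (U s y)); last by apply: heat_eq_opp; apply: he; lra.
    apply: le_trans (ler_norm _) _; rewrite normrN; apply: fM.
    by have := hr s y ltac:(lra); lra.
have htr := hT' t tT'.
rewrite !divr1 in hup hlo; rewrite ler_distl.
have : 0 <= b * x by apply: mulr_ge0; lra.
have : b * x <= x by apply: ler_piMl; lra.
have : 0 <= e * x by apply: mulr_ge0; lra.
have : e * x <= e by apply: ler_piMr; lra.
by move: hup hlo htr; set E := expR _; move=> *; apply/andP; split; lra.
Qed.

Variables (V : R -> R) (U : R -> R -> R).
Hypothesis hU : halfline_solution f U.
Hypothesis hV : forall x, 0 <= x -> U t x @[t --> +oo] --> V x.

Lemma modulus_at (a e : R) : 0 <= a -> 0 < e -> exists T, forall t x,
  T <= t -> a <= x <= a + 1 -> `|U t x - V a| <= e + (M + 2) * (x - a).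
Proof.
move=> a0 e0; have hs := halfline_solution_shift a0 hU.
have ha : U t (a + 0) @[t --> +oo] --> V a by rewrite addr0; exact: hV.
have [T hT] := boundary_modulus hs ha e0.
exists T => t x Tt xI; have := hT t (x - a) Tt ltac:(lra).
by rewrite (_ : a + (x - a) = x)//; ring.
Qed.

Lemma profile_lipschitz (x y : R) : 0 <= x -> x <= y <= x + 1 ->
  `|V y - V x| <= (M + 2) * (y - x).
Proof.
move=> x0 xy; apply/ler_addgt0Pr => e e0; rewrite [leRHS]addrC.
have [T hT] := modulus_at x0 e0; have y0 : 0 <= y by lra.
by apply: (cvgy_dist (hV y0) (T := T)) => t Tt; exact: hT.
Qed.

Lemma profile_range (x : R) : 0 <= x -> 0 <= V x <= 1.
Proof.
move=> x0; apply/andP; split.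
  by apply: (cvgy_ge (hV x0) (T := 0)) => t _; have := hs_range hU t x0; lra.
by apply: (cvgy_le (hV x0) (T := 0)) => t _; have := hs_range hU t x0; lra.
Qed.

(** The common modulus upgrades pointwise to locally uniform convergence. *)
Lemma profile_uniform (L e : R) : 0 < e -> exists T, forall t x,
  T <= t -> 0 <= x <= L -> `|U t x - V x| <= e.
Proof.
move=> e0; have M0 := source_bound_ge0.
pose h := Num.min 1 (e / (4 * (M + 2))).
have h0 : 0 < h by rewrite /h lt_min ltr01 divr_gt0//; lra.
have h1 : h <= 1 by rewrite /h ge_min lexx.
have he : (M + 2) * h <= e / 4.
  have : h <= e / (4 * (M + 2)) by rewrite /h ge_min lexx orbT.
  rewrite ler_pdivlMr; lra.
have key (n : nat) : exists T, forall t x, T <= t -> 0 <= x <= n%:R * h -> `|U t x - V x| <= e.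
  elim: n => [|n [T hT]].
    have [T hT] := cvgy_eventually (hV (lexx 0)) e0.
    exists T => t x Tt; rewrite mul0r => xI.
    have -> : x = 0 by lra.
    exact: hT.
  have a0 : 0 <= n%:R * h by apply: mulr_ge0 => //; exact: ltW.
  have e20 : 0 < e / 2 by lra.
  have [T' hT'] := modulus_at a0 e20.
  exists (Num.max T T') => t x; rewrite ge_max => /andP[tT tT'].
  rewrite -natr1 mulrDl mul1r => xI.
  case: (leP x (n%:R * h)) => xn; first by apply: hT => //; lra.
  have h2 := hT' t x tT' ltac:(lra).
  have xI' : n%:R * h <= x <= n%:R * h + 1 by lra.
  have h3 := profile_lipschitz a0 xI'.
  have h4 : (M + 2) * (x - n%:R * h) <= (M + 2) * h by apply: ler_wpM2l; lra.
  have := ler_distD (V (n%:R * h)) (U t x) (V x).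
  by rewrite [`|V (n%:R * h) - V x|]distrC; lra.
have [T hT] := key (Num.truncn (L / h)).+1.
exists T => t x Tt xI; apply: hT => //; apply/andP; split; first by lra.
have := truncnS_gt (L / h); rewrite ltr_pdivrMr//; lra.
Qed.

(** Extending the profile by a constant to the left of 0 makes its source term continuous
on the whole line, so that it has antiderivatives there. *)
Lemma profile_continuous : continuous (fun x : R => V (Num.max 0 x)).
Proof.
move=> x; apply/cvgrPdist_le => e e0; have M0 := source_bound_ge0.
have K0 : 0 < M + 2 by lra.
have hd : 0 < Num.min 1 (e / (M + 2)) by rewrite lt_min ltr01 divr_gt0.
have : \forall y \near x, `|x - y| < Num.min 1 (e / (M + 2)).
  exact: nbhsx_ballx hd.
apply: filterS => y; rewrite lt_min => /andP[xy1]; rewrite ltr_pdivlMr// => xy2.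
have hm : `|Num.max 0 x - Num.max 0 y| <= `|x - y|.
  rewrite /Num.max; case: ltP => x0; case: ltP => y0; rewrite ?subrr ?normr0//.
  - by rewrite ger0_norm; [have := ler_norm (x - y); lra|lra].
  - by rewrite ler0_norm; [have := ler_norm (- (x - y)); rewrite normrN; lra|lra].
have hx : 0 <= Num.max 0 x by rewrite le_max lexx.
have hy : 0 <= Num.max 0 y by rewrite le_max lexx.
move: hm hx hy; set X := Num.max 0 x; set Y := Num.max 0 y => hm hx hy.
apply: (@le_trans _ _ ((M + 2) * `|X - Y|)); last first.
  by apply: (@le_trans _ _ ((M + 2) * `|x - y|)); [apply: ler_wpM2l; lra|lra].
case: (leP X Y) => XY.
  rewrite ler0_norm in hm *; last by lra.
  rewrite distrC (_ : - (X - Y) = Y - X); last by ring.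
  by apply: profile_lipschitz; lra.
rewrite (ger0_norm (_ : 0 <= X - Y)) in hm *; [|by lra..].
by apply: profile_lipschitz; lra.
Qed.

(** The limit is a steady state: the difference between [U] and the solution of
[p'' = - f (V)] with the boundary values of [V] has small boundary values and a small
source at large times, so that it vanishes in the limit. *)
Lemma profile_steady (La : R) : continuous f ->
  (forall r s, 0 <= r <= 1 -> 0 <= s <= 1 -> `|f r - f s| <= La * `|r - s|) -> exists W W1 : R -> R,
  [/\ forall x, 0 <= x -> W x = V x, forall x : R, is_derive x 1 W (W1 x)
    & forall x : R, 0 <= x -> is_derive x 1 W1 (- f (V x))].
Proof.
move=> cf fL; pose g (x : R) : R := f (V (Num.max 0 x)).
have cg : continuous g.
  move=> x; apply: (@continuous_comp _ _ _ (fun x : R => V (Num.max 0 x)) f).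
    exact: profile_continuous.
  exact: cf.
have gE x : 0 <= x -> g x = f (V x) by move=> x0; rewrite /g (max_idPr _).
have [P1 [_ hP1]] := antiderivative_exists cg.
have cP1 : continuous P1 by move=> x; exact: is_derive_continuous (hP1 x).
have [P2 [P20 hP2]] := antiderivative_exists cP1.
have hchord L : 0 < L -> forall x, 0 <= x <= L ->
    V x + P2 x = V 0 + (V L + P2 L - V 0) / L * x.
  move=> L0 x xI.
  pose A := V 0; pose B := (V L + P2 L - V 0) / L.
  pose q (x : R) : R := P2 x - (A + B * x).
  have AB : A + B * L = V L + P2 L by rewrite /A /B mulfVK ?gt_eqF//; ring.
  have q0 : q 0 = - V 0 by rewrite /q P20 /A; ring.
  have qL : q L = - V L by rewrite /q AB; ring.
  have cq : continuous q.
    move=> y; apply: cvgB; first exact: is_derive_continuous (hP2 y).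
    by apply: cvgD; [exact: cvg_cst|apply: cvgM; [exact: cvg_cst|exact: cvg_id]].
  pose Y t x := U t x + q x.
  have eY t y m : heat_eq U t y m -> heat_eq Y t y (m - g y).
    move=> [ut [uxx [h1 h2 h3]]]; exists (ut + 0), (uxx + (g y - 2 * 0)); split.
    - exact: is_derive_fun_add h1 (is_derive_fun_cst _ _).
    - apply: has_d2_add h2 _.
      have hp : has_d2 P2 y (g y).
        exists P1; split; last exact: hP1.
        have : \forall y' \near y, y - 1 < y' by apply: near_above; lra.
        by apply: filterS => y' _; exact: hP2.
      have := has_d2_sub hp (has_d2_quadratic y A B 0).
      rewrite (_ : (fun z => P2 z - _) = q)//.
      by apply/funext => z; rewrite /q mul0r addr0.
    - by lra.
  have cY : {within [set p : R * R | 0 <= p.2], continuous (fun p => Y p.1 p.2)}.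
    move=> p; apply: cvgD; first exact: (hs_continuous hU).
    apply: (@continuous_subspaceT _ _ _ (fun p : R * R => q p.2)) => r.
    by apply: (@continuous_comp _ _ _ snd q); [exact: cvg_snd|exact: cq].
  have [C [C0 hC]] : exists C, 0 <= C /\ forall y, 0 <= y <= L -> `|q y| <= C.
    have cq' : {within `[0, L], continuous (fun y => `|q y|)}.
      apply: continuous_subspaceT => y.
      by apply: (@continuous_comp _ _ _ q Num.norm); [exact: cq|exact: norm_continuous].
    have [c _ hc] := EVT_max (ltW L0) cq'.
    by exists `|q c|; split => // y yI; apply: hc; rewrite in_itv.
  have small e : 0 < e -> `|V x + q x| <= e * (2 + L ^+ 2).
    move=> e0; pose d := e / (`|La| + 1).
    have L1 : 0 < `|La| + 1 by rewrite ltr_wpDl.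
    have d0 : 0 < d by rewrite divr_gt0.
    have dL : (`|La| + 1) * d = e by rewrite /d mulrC mulfVK// gt_eqF.
    have [T1 hT1] := profile_uniform L d0.
    have src t y : T1 <= t -> 0 < y < L -> `|f (U t y) - g y| <= e.
      move=> tT yI; rewrite gE; last by lra.
      have y0 : 0 <= y by lra.
      have h1 : 0 <= U t y <= 1 by have := hs_range hU t y0; lra.
      have h2 := fL _ _ h1 (profile_range y0).
      have h3 := hT1 t y tT ltac:(lra).
      apply: (le_trans h2); apply: (@le_trans _ _ (`|La| * `|U t y - V y|)).
        by rewrite ler_wpM2r// ler_norm.
      apply: (@le_trans _ _ (`|La| * d)); first by rewrite ler_wpM2l.
      by rewrite -dL; lra.
    have Ld : 0 <= `|La| * d by apply: mulr_ge0 => //; exact: ltW.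
    have de : d <= e by lra.
    have iL : 0 < (L ^+ 2)^-1 by rewrite invr_gt0 exprn_gt0.
    have [T2 T12 hT2] := @transient_small (L ^+ 2)^-1 T1 (2 * (C + 1)) e iL ltac:(lra) e0.
    have x0 : 0 <= x by lra.
    rewrite -[q x]opprK; apply: (cvgy_dist (hV x0) (T := T2)).
    move=> t tT2; rewrite opprK.
    have h0 := hT1.
    have hbx : e / 2 * x * (L - x) <= e * L ^+ 2.
      have : x * (L - x) <= L ^+ 2 by nra.
      move=> h; have := ler_wpM2l (ltW e0) h.
      have : 0 <= x * (L - x) by apply: mulr_ge0; lra.
      by move=> h'; have := ler_wpM2l (ltW e0) h'; lra.
    have YC s y : 0 <= y <= L -> - (C + 1) <= Y s y <= C + 1.
      move=> yI; have := hC y yI; rewrite ler_norml.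
      have y0 : 0 <= y by lra.
      by have := hs_range hU s y0; rewrite /Y; lra.
    have Yb s : T1 <= s -> - e <= Y s 0 <= e /\ - e <= Y s L <= e.
      move=> sT; have := hT1 s 0 sT ltac:(lra); have := hT1 s L sT ltac:(lra).
      by rewrite /Y q0 qL !ler_norml; lra.
    have tT1 : T1 <= t by lra.
    have hup : Y t x <= e + (e - e) / L * x + e / 2 * x * (L - x)
        + expR (- (L ^+ 2)^-1 * (t - T1)) * (2 * (C + 1)).
      apply: (barrier_interval (Y := Y)) => //; [exact: ltW|lra| | |].
      - by move=> s sT; have := Yb s sT; lra.
      - by move=> y yI; have := YC T1 y yI; lra.
      - move=> s y sT yI; exists (f (U s y) - g y).
          by have := src s y (ltW sT) yI; rewrite ler_norml; lra.
        by apply: eY; apply: (hs_equation hU); lra.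
    have hlo : - Y t x <= e + (e - e) / L * x + e / 2 * x * (L - x)
        + expR (- (L ^+ 2)^-1 * (t - T1)) * (2 * (C + 1)).
      apply: (barrier_interval (Y := fun t x => - Y t x)) => //; [exact: ltW|lra| | | |].
      - move=> p; apply: cvgN; exact: cY.
      - by move=> s sT; have := Yb s sT; lra.
      - by move=> y yI; have := YC T1 y yI; lra.
      - move=> s y sT yI; exists (- (f (U s y) - g y)).
          by have := src s y (ltW sT) yI; rewrite ler_norml; lra.
        by apply: heat_eq_opp; apply: eY; apply: (hs_equation hU); lra.
    have := hT2 t tT2; rewrite ler_norml; move: hup hlo; rewrite subrr !mul0r -/(Y t x).
    by set E := expR _; move=> h1 h2 h3; apply/andP; split; lra.
  have : V x + q x = 0; last by rewrite /q /A /B; lra.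
  apply/eqP; rewrite -normr_le0; apply/ler_addgt0Pr => e e0; rewrite add0r.
  have L2 : 0 < 2 + L ^+ 2 by rewrite ltr_wpDr// sqr_ge0.
  by have := small (e / (2 + L ^+ 2)) (divr_gt0 e0 L2); rewrite mulfVK// gt_eqF.
pose s := (V 1 + P2 1 - V 0) / 1.
have hV' x : 0 <= x -> V x = V 0 + s * x - P2 x.
  move=> x0; have x1 : 0 < x + 1 by lra.
  have h1 := hchord (x + 1) x1 x ltac:(lra).
  have h2 := hchord (x + 1) x1 1 ltac:(lra).
  have h3 := hchord 1 ltr01 1 ltac:(lra).
  move: h1 h2 h3; rewrite -/s; set b := (_ / (x + 1)) => h1 h2 h3.
  have -> : s = b by lra.
  by lra.
exists (fun x => V 0 + s * x - P2 x), (fun x => s - P1 x); split.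
- by move=> x x0; rewrite [RHS]hV'.
- move=> x; have h := is_derive_fun_sub (is_derive_fun_add (is_derive_fun_cst x (V 0))
    (is_derive_fun_scale s (is_derive_fun_id x))) (hP2 x).
  by apply: is_derive_eq h _; ring.
- move=> x x0; have h := is_derive_fun_sub (is_derive_fun_cst x s) (hP1 x).
  by apply: is_derive_eq h _; rewrite gE//; ring.
Qed.
End Modulus.
End SteadyState.

(** * Bistable nonlinearities *)

Section MeanValue.
Context {R : realType}.
Implicit Types (g dg : R -> R) (a b : R).

Lemma mean_value g dg a b : a < b ->
  (forall x : R, a <= x <= b -> is_derive x 1 g (dg x)) ->
  exists2 c, a < c < b & g b - g a = dg c * (b - a).
Proof.
move=> ab hg.
have cg : {within `[a, b], continuous g}.
  by apply: derivable_within_continuous => x /[!in_itv]/= xI; have [] := hg x xI.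
have hg' x : x \in `]a, b[ -> is_derive x 1 g (dg x).
  by rewrite in_itv/= => /andP[? ?]; apply: hg; rewrite !ltW.
by have [c /[!in_itv]/= cI e] := MVT ab hg' cg; exists c.
Qed.

Lemma mean_value_le g dg a b m : a <= b ->
  (forall x : R, a <= x <= b -> is_derive x 1 g (dg x)) ->
  (forall x, a <= x <= b -> dg x <= m) -> g b - g a <= m * (b - a).
Proof.
rewrite le_eqVlt => /predU1P[->|ab] hg hm; first by rewrite !subrr mulr0.
have [c cI ->] := mean_value ab hg.
by apply: ler_wpM2r; [lra|apply: hm; lra].
Qed.

Lemma mean_value_ge g dg a b m : a <= b ->
  (forall x : R, a <= x <= b -> is_derive x 1 g (dg x)) ->
  (forall x, a <= x <= b -> m <= dg x) -> m * (b - a) <= g b - g a.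
Proof.
rewrite le_eqVlt => /predU1P[->|ab] hg hm; first by rewrite !subrr mulr0.
have [c cI ->] := mean_value ab hg.
by apply: ler_wpM2r; [lra|apply: hm; lra].
Qed.

End MeanValue.

Section Bistable.
Context {R : realType}.
Variables (f : R -> R) (a : R).
Hypothesis hf : bistable f a.

Lemma bistable_is_derive (s : R) : is_derive s 1 f (derive1 f s).
Proof. by split; [exact: bistable_derivable hf s|rewrite derive1E]. Qed.

Lemma bistable_continuous : continuous f.
Proof. by move=> s; exact: is_derive_continuous (bistable_is_derive s). Qed.

Lemma bistable_lipschitz : exists2 La : R, 0 < La &
  forall r s, 0 <= r <= 1 -> 0 <= s <= 1 -> `|f r - f s| <= La * `|r - s|.
Proof.
have cn : {within `[0, 1], continuous (fun s => `|derive1 f s|)}.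
  apply: continuous_subspaceT => s.
  by apply: (@continuous_comp _ _ _ (derive1 f) Num.norm);
    [exact: (bistable_C1 hf)|exact: norm_continuous].
have [c _ hc] := EVT_max ler01 cn.
exists (`|derive1 f c| + 1); first by rewrite ltr_wpDl.
have key r s : 0 <= r -> r <= s -> s <= 1 -> `|f s - f r| <= `|derive1 f c| * (s - r).
  rewrite [r <= s]le_eqVlt => r0 /predU1P[->|rs] s1; first by rewrite !subrr normr0 mulr0.
  have [d dI ->] := mean_value rs (fun x _ => bistable_is_derive x).
  rewrite normrM (gtr0_norm (_ : 0 < s - r)) ?subr_gt0//.
  apply: ler_wpM2r; first by lra.
  by apply: hc; rewrite in_itv/=; lra.
move=> r s rI sI; case: (leP r s) => rs.
  have := key r s ltac:(lra) rs ltac:(lra).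
  by rewrite distrC (distrC r) (ger0_norm (_ : 0 <= s - r)); lra.
have := key s r ltac:(lra) (ltW rs) ltac:(lra).
by rewrite (ger0_norm (_ : 0 <= r - s)); lra.
Qed.

(** As [f'] is negative at 0 and at 1, it stays below a common [- mu] near both zeros;
this is the damping rate in the ancient comparison arguments. *)
Lemma bistable_contraction : exists de mu : R, [/\ 0 < de < 1, 0 < mu &
  forall r s, r <= s -> (0 <= r /\ s <= de) \/ (1 - de <= r /\ s <= 1) ->
    mu * (s - r) <= f r - f s].
Proof.
have near_zero (x0 : R) : derive1 f x0 < 0 -> exists2 e, 0 < e &
    forall y, `|x0 - y| < e -> derive1 f y <= derive1 f x0 / 2.
  move=> h; have h' : 0 < - (derive1 f x0 / 2) by lra.
  have /cvgrPdist_lt/(_ _ h')/nbhs_ballP[e /= e0 he] := bistable_C1 hf (x := x0).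
  exists e => // y ye; have := he y ye; rewrite ltr_distl; lra.
have [e0 e00 he0] := near_zero 0 (bistable_df0 hf).
have [e1 e10 he1] := near_zero 1 (bistable_df1 hf).
have h0 := bistable_df0 hf; have h1 := bistable_df1 hf.
pose de := Num.min (1 / 2) (Num.min e0 e1 / 2).
pose mu := Num.min (- (derive1 f 0 / 2)) (- (derive1 f 1 / 2)).
have m0 : 0 < Num.min e0 e1 by rewrite lt_min e00 e10.
have de0 : 0 < de by rewrite lt_min; apply/andP; split; lra.
have dehalf : de <= 1 / 2 by rewrite ge_min lexx.
have dee : de <= Num.min e0 e1 / 2 by rewrite ge_min lexx orbT.
have me0 : Num.min e0 e1 <= e0 by rewrite ge_min lexx.
have me1 : Num.min e0 e1 <= e1 by rewrite ge_min lexx orbT.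
have mu0 : mu <= - (derive1 f 0 / 2) by rewrite ge_min lexx.
have mu1 : mu <= - (derive1 f 1 / 2) by rewrite ge_min lexx orbT.
exists de, mu; split; first by lra.
  by rewrite lt_min; apply/andP; split; lra.
move=> r s rs hrs.
suff : f s - f r <= - mu * (s - r) by lra.
apply: (mean_value_le rs (fun x _ => bistable_is_derive x)) => x xI.
case: hrs => [[r0 sd]|[r1 s1]].
  apply: (le_trans (he0 x _)); last by lra.
  by rewrite sub0r normrN ger0_norm; lra.
apply: (le_trans (he1 x _)); last by lra.
by rewrite ger0_norm; lra.
Qed.

Variables (F : R -> R) (beta : R).
Hypothesis F0 : F 0 = 0.
Hypothesis hF : forall x : R, is_derive x 1 F (f x).
Hypothesis hbeta : a < beta < 1.
Hypothesis Fbeta : F beta = 0.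

Lemma potential_decr (r s : R) : 0 <= r -> r < s -> s <= a -> F s < F r.
Proof.
move=> r0 rs sa; have [c cI e] := mean_value rs (fun x _ => hF x).
rewrite -subr_lt0 e nmulr_rlt0; first by rewrite subr_gt0.
by apply: (bistable_neg hf); lra.
Qed.

Lemma potential_incr (r s : R) : a <= r -> r < s -> s <= 1 -> F r < F s.
Proof.
move=> r0 rs sa; have [c cI e] := mean_value rs (fun x _ => hF x).
rewrite -subr_gt0 e pmulr_rgt0; first by rewrite subr_gt0.
by apply: (bistable_pos hf); lra.
Qed.

Lemma potential_lt0 (s : R) : 0 < s < beta -> F s < 0.
Proof.
move=> sI; have hb := hbeta; case: (leP s a) => sa.
  by rewrite -F0; apply: potential_decr; lra.
by rewrite -Fbeta; apply: potential_incr; lra.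
Qed.

Lemma potential_le0 (s : R) : 0 <= s <= beta -> F s <= 0.
Proof.
move=> /andP[]; rewrite le_eqVlt => /predU1P[<-|s0]; first by rewrite F0.
rewrite le_eqVlt => /predU1P[->|s1]; first by rewrite Fbeta.
by apply: ltW; apply: potential_lt0; rewrite s0.
Qed.

(** * Steady states above the level beta *)

(** The energy [W'^2 / 2 + F (W)] is positive, since [W] exceeds [beta] somewhere. Suppose
that [W] decreases at some point. It has no turning point later on: there [F (W)] would
equal the energy, hence [W] would exceed [beta], where [F] increases, at a level lower than
the one where it decreased. Without turning points the energy keeps the slope away from 0
until [W] becomes negative. Hence [W] is nondecreasing. If its limit were less than 1, then
[W'' = - f (W)] would stay below a negative constant and [W'] would become negative. *)
Lemma steady_above_beta (W W1 : R -> R) (x0 : R) :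
  (forall x : R, is_derive x 1 W (W1 x)) ->
  (forall x : R, 0 <= x -> is_derive x 1 W1 (- f (W x))) ->
  (forall x, 0 <= x -> 0 <= W x <= 1) -> 0 <= x0 -> beta < W x0 ->
  (forall x y, 0 <= x -> x <= y -> W x <= W y) /\
  (forall e, 0 < e -> exists X, forall x, X <= x -> 1 - e <= W x).
Proof.
move=> hW hW1 W01 x00 Wx0; have ha := bistable_a hf; have hb := hbeta.
pose E x := W1 x ^+ 2 / 2 + F (W x).
have hE (x : R) : 0 <= x -> is_derive x 1 E 0.
  move=> x0'; have h1 := is_derive_fun_scale (2^-1) (is_derive_fun_sqr (hW1 x x0')).
  have h2 := is_derive_fun_comp (hF (W x)) (hW x).
  have h := is_derive_fun_add h1 h2.
  rewrite (_ : (fun y => _ + _) = E) in h; last first.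
    by apply/funext => y; rewrite /E mulrC.
  by apply: is_derive_eq h _; field.
have EE x : 0 <= x -> E x = E 0.
  move=> x0'; apply/esym; apply: is_derive0_const => // y yI; apply: hE; lra.
have E0 : 0 < E 0.
  rewrite -(EE x0 x00) /E.
  have : 0 < F (W x0) by rewrite -Fbeta; apply: potential_incr; have := W01 x0 x00; lra.
  by have := sqr_ge0 (W1 x0); lra.
have W1ge0 x1 : 0 <= x1 -> 0 <= W1 x1.
  move=> x10; rewrite leNgt; apply/negP => W1x1.
  have neg x2 : x1 <= x2 -> W1 x2 < 0.
    rewrite le_eqVlt => /predU1P[<-//|x12]; rewrite ltNge; apply/negP => W1x2.
    have cW : {within `[x1, x2], continuous W}.
      by apply: continuous_subspaceT => y; exact: is_derive_continuous (hW y).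
    have [c /[!in_itv]/= cI hc] := EVT_min (ltW x12) cW.
    have hcm y : x1 <= y <= x2 -> W c <= W y by move=> ?; apply: hc; rewrite in_itv.
    have Wcx1 : W c < W x1.
      have := derive_pos_right (is_derive_fun_opp (hW x1)).
      rewrite oppr_gt0 => /(_ W1x1)/at_right_ex[e e0 he].
      pose y := Num.min x2 (x1 + e / 2).
      have y1 : x1 < y by rewrite lt_min x12; lra.
      have y2 : y <= x2 by rewrite ge_min lexx.
      have y3 : y <= x1 + e / 2 by rewrite ge_min lexx orbT.
      have := he y ltac:(lra); rewrite ltrN2 => Wy.
      by apply: le_lt_trans Wy; apply: hcm; lra.
    have x1c : x1 < c.
      rewrite lt_neqAle; apply/andP; split; last by lra.
      by apply/eqP => ec; move: Wcx1; rewrite ec ltxx.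
    have W1c : W1 c = 0.
      apply/eqP; rewrite eq_le; apply/andP; split.
        apply: (is_derive_le_of_left_min (hW c)).
        near=> y; apply: hcm; apply/andP; split; near: y.
          exact: nbhs_left_ge.
        by apply: filterS (nbhs_left_le c) => y; lra.
      case: (ltP c x2) => cx2; last by have -> : c = x2 by lra.
      apply: (is_derive_ge_of_right_min (hW c)).
      near=> y; apply: hcm; apply/andP; split; near: y.
        by apply: filterS (nbhs_right_ge c) => y; lra.
      exact: nbhs_right_le.
    have c0 : 0 <= c by lra.
    have Ec : F (W c) = E 0 by rewrite -(EE c c0) /E W1c expr0n /= mul0r add0r.
    have Wc : beta < W c.
      rewrite ltNge; apply/negP => h; have := potential_le0 (s := W c).
      by rewrite h Ec; have := W01 c c0; lra.
    have : F (W c) < F (W x1) by apply: potential_incr; have := W01 x1 x10; lra.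
    by have := EE x1 x10; rewrite {1}/E; have := sqr_ge0 (W1 x1); lra.
  have decr x : x1 <= x -> W x <= W x1.
    move=> x1x; have := mean_value_le x1x (fun y _ => hW y) (m := 0).
    by rewrite mul0r subr_le0; apply => y yI; apply: ltW; apply: neg; lra.
  (* W1^2 = 2 (E 0 - F (W)), and F (W) is at most 0 or at most F (W x1) *)
  pose m := Num.min (2 * E 0) (W1 x1 ^+ 2).
  have m0 : 0 < m by rewrite lt_min exprn_even_gt0//= lt_eqF// andbT; lra.
  have m1 : m <= 2 * E 0 by rewrite ge_min lexx.
  have m2 : m <= W1 x1 ^+ 2 by rewrite ge_min lexx orbT.
  have slope x : x1 <= x -> m <= W1 x ^+ 2.
    move=> x1x; have x0' : 0 <= x by lra.
    have := EE x x0'; rewrite {1}/E => e2; have := EE x1 x10; rewrite {1}/E => e1.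
    case: (leP (W x) beta) => Wx.
      by have := potential_le0 (s := W x); rewrite Wx; have := W01 x x0'; lra.
    have : F (W x) <= F (W x1); last by lra.
    have := decr x x1x; rewrite le_eqVlt => /predU1P[->//|h].
    by apply: ltW; apply: potential_incr; have := W01 x1 x10; lra.
  pose k := Num.min 1 m.
  have k0 : 0 < k by rewrite lt_min ltr01.
  have k1 : k <= 1 by rewrite ge_min lexx.
  have k2 : k <= m by rewrite ge_min lexx orbT.
  have steep x : x1 <= x -> W1 x <= - k.
    move=> x1x; rewrite leNgt; apply/negP => h.
    by have := slope x x1x; have := neg x x1x; rewrite expr2; nra.
  have x2x : x1 <= x1 + 2 / k by rewrite lerDl divr_ge0// ltW.
  have := mean_value_le x2x (fun y _ => hW y) (m := - k) (fun y yI => steep y ltac:(lra)).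
  have -> : - k * (x1 + 2 / k - x1) = - 2 by field; rewrite gt_eqF.
  by have := W01 x1 x10; have := W01 (x1 + 2 / k) ltac:(lra); lra.
have incr x y : 0 <= x -> x <= y -> W x <= W y.
  move=> x0' xy; have := mean_value_ge xy (fun y _ => hW y) (m := 0).
  by rewrite mul0r subr_ge0; apply => z zI; apply: W1ge0; lra.
split => // e e0.
have [[X [X0 hX]]|no] := pselect (exists X, 0 <= X /\ 1 - e <= W X).
  by exists X => x Xx; apply: (le_trans hX); exact: incr.
have below x : 0 <= x -> W x < 1 - e.
  by move=> x0'; rewrite ltNge; apply/negP => h; apply: no; exists x.
have le1 : W x0 <= 1 - e by apply: ltW; exact: below.
have cf : {within `[W x0, 1 - e], continuous f}.
  by apply: continuous_subspaceT; exact: bistable_continuous.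
have [c /[!in_itv]/= cI hc] := EVT_min le1 cf.
have fc : 0 < f c by apply: (bistable_pos hf); lra.
have := W1ge0 x0 x00 => W1x0.
have x2x : x0 <= x0 + (W1 x0 + 1) / f c.
  by rewrite lerDl divr_ge0//; [lra|exact: ltW].
have hW1' (y : R) : x0 <= y <= x0 + (W1 x0 + 1) / f c -> is_derive y 1 W1 (- f (W y)).
  by move=> yI; apply: hW1; lra.
have := mean_value_le x2x hW1' (m := - f c).
have -> : - f c * (x0 + (W1 x0 + 1) / f c - x0) = - (W1 x0 + 1) by field; rewrite gt_eqF.
move=> h; exfalso.
have : W1 (x0 + (W1 x0 + 1) / f c) - W1 x0 <= - (W1 x0 + 1).
  apply: h => y yI; rewrite lerN2; apply: hc; rewrite in_itv/=.
  by rewrite incr//=; [apply: ltW; apply: below; lra|lra].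
have : 0 <= W1 (x0 + (W1 x0 + 1) / f c) by apply: W1ge0; lra.
lra.
Unshelve. all: by end_near. Qed.

End Bistable.

(** * The homoclinic steady state *)

Section Homoclinic.
Context {R : realType}.

(** A scalar equation [Y' = K Y] with [K] continuous, positive and bounded is solved
globally by inverting the antiderivative of [1 / K]. *)
Lemma autonomous_flow (K : R -> R) (B : R) : continuous K ->
  (forall y, 0 < K y) -> (forall y, K y <= B) ->
  exists Y : R -> R, [/\ Y 0 = 0, forall x : R, is_derive x 1 Y (K (Y x)),
    {homo Y : x y / x < y} & forall m, exists x, 0 <= x /\ m <= Y x].
Proof.
move=> cK K0 KB.
have B0 : 0 < B by apply: lt_le_trans (K0 0) (KB 0).
have ck : continuous (fun y : R => (K y)^-1).
  by move=> y; apply: cvgV; [rewrite gt_eqF|exact: cK].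
have [T [T0 hT]] := antiderivative_exists ck.
have Tgrow x y : x <= y -> B^-1 * (y - x) <= T y - T x.
  move=> xy; apply: (mean_value_ge xy (fun z _ => hT z)) => z _.
  by rewrite lef_pV2 ?posrE.
have B'0 : 0 < B^-1 by rewrite invr_gt0.
have Tmono x y : x < y -> T x < T y.
  move=> xy; have := Tgrow x y (ltW xy).
  have : 0 < B^-1 * (y - x) by rewrite mulr_gt0// subr_gt0.
  lra.
have cT : continuous T by move=> y; exact: is_derive_continuous (hT y).
have Tsurj x : exists y, T y = x.
  have n0 : 0 <= `|x| * B by rewrite mulr_ge0// ltW.
  have h1 := Tgrow 0 (`|x| * B) n0.
  have h2 := Tgrow (- (`|x| * B)) 0 ltac:(lra).
  rewrite subr0 T0 subr0 mulrC mulfK ?gt_eqF// in h1.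
  rewrite sub0r opprK T0 mulrC mulfK ?gt_eqF// in h2.
  have le : - (`|x| * B) <= `|x| * B by lra.
  have hx1 := ler_norm x; have hx2 := ler_norm (- x); rewrite normrN in hx2.
  have mm : Num.min (T (- (`|x| * B))) (T (`|x| * B)) <= x
      <= Num.max (T (- (`|x| * B))) (T (`|x| * B)).
    by rewrite ge_min le_max; apply/andP; split; apply/orP; [left|right]; lra.
  have [c _ e] := IVT le (continuous_subspaceT cT) mm.
  by exists c.
have [Y TY] := choice Tsurj.
have YT y : Y (T y) = y.
  apply/eqP; rewrite eq_le !leNgt; apply/andP; split; apply/negP => /Tmono; rewrite TY ltxx//.
have Ymono : {homo Y : x y / x < y}.
  move=> x y xy; rewrite ltNge; apply/negP; rewrite le_eqVlt => /predU1P[e|/Tmono].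
    by move: xy; rewrite -(TY x) -(TY y) e ltxx.
  by rewrite !TY ltNge ltW.
exists Y; split => //.
- by rewrite -T0 YT.
- move=> x.
  have near_all (P : R -> Prop) (z : R) : (forall y, P y) -> \forall y \near z, P y.
    move=> h; have lt : z - 1 < z by lra.
    by have := near_above lt; apply: filterS.
  have h1 : {near Y x, cancel T Y} by apply: near_all => y; exact: YT.
  have h2 : {near Y x, continuous T} by apply: near_all => y; exact: cT.
  have n0 : (K (Y x))^-1 != 0 by rewrite invr_eq0 gt_eqF.
  by have := is_derive_inverse h1 h2 (hT (Y x)) n0; rewrite TY invrK.
- move=> m; have m0 : 0 <= `|m| by [].
  exists (T `|m|); rewrite YT ler_norm; split => //.
  have := Tgrow _ _ m0; rewrite T0 !subr0; apply: le_trans.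
  by rewrite mulr_ge0// ltW.
Qed.

Variables (f F : R -> R) (beta La : R).
Hypothesis F0 : F 0 = 0.
Hypothesis hF : forall x : R, is_derive x 1 F (f x).
Hypothesis Fbeta : F beta = 0.
Hypothesis beta0 : 0 < beta.
Hypothesis Fneg : forall s, 0 < s < beta -> F s < 0.
Hypothesis fbeta : 0 < f beta.
Hypothesis fLa : forall s, 0 <= s <= beta -> `|f s| <= La * s.

Let E (r : R) : R := beta * expR (- r).
Let G (r : R) : R := - 2 * F (E r) / (E r) ^+ 2.

Let E_gt0 r : 0 < E r.
Proof. by rewrite mulr_gt0// expR_gt0. Qed.

Let E_lt r : 0 < r -> E r < beta.
Proof. by move=> r0; rewrite /E gtr_pMr// -expR0 ltr_expR; lra. Qed.

Let is_derive_E (r : R) : is_derive r 1 E (- E r).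
Proof.
have h := is_derive_fun_scale beta
  (is_derive_fun_comp (is_derive_expR (- r)) (is_derive_fun_opp (is_derive_fun_id r))).
by apply: is_derive_eq h _; rewrite /E; ring.
Qed.

Let is_derive_G (r : R) : exists d : R, is_derive r 1 G d /\ (r = 0 -> 0 < d).
Proof.
have h1 := is_derive_fun_comp (hF (E r)) (is_derive_E r).
have h2 := is_derive_fun_sqr (is_derive_E r).
have n2 : E r ^+ 2 != 0 by rewrite gt_eqF// exprn_gt0// E_gt0.
have h3 := @is_deriveV R (fun y => E y ^+ 2) r _ 1 n2 h2.
have h := is_derive_fun_mul (is_derive_fun_scale (- 2) h1) h3.
exists (- 2 * (f (E r) * - E r) / E r ^+ 2 + - 2 * F (E r) * (- (E r ^+ 2) ^- 2 *: (2 * E r * - E r))).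
split; first exact: h.
move=> ->; have -> : E 0 = beta by rewrite /E oppr0 expR0 mulr1.
rewrite Fbeta mulr0 mul0r addr0 (_ : _ / _ = 2 * f beta / beta); last by field; rewrite gt_eqF.
by rewrite divr_gt0// mulr_gt0.
Qed.

Let G0 : G 0 = 0.
Proof. by rewrite /G /E oppr0 expR0 mulr1 Fbeta mulr0 mul0r. Qed.

Let G_gt0 r : 0 < r -> 0 < G r.
Proof.
move=> r0; rewrite divr_gt0// ?exprn_gt0 ?E_gt0//.
by have := Fneg (s := E r); rewrite E_gt0 E_lt//; lra.
Qed.

Let La0 : 0 <= La.
Proof.
have := fLa (s := beta); rewrite lexx ltW//= => /(_ isT) h.
by have : 0 <= La * beta by [exact: le_trans h]; rewrite pmulr_lge0.
Qed.

Let G_le r : 0 < r -> G r <= 2 * La.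
Proof.
move=> r0; have e0 := E_gt0 r; have el := E_lt r0.
rewrite /G ler_pdivrMr ?exprn_gt0//.
have : - La * E r * (E r - 0) <= F (E r) - F 0.
  apply: (mean_value_ge (ltW e0) (fun z _ => hF z)) => z zI.
  have := fLa (s := z) ltac:(lra); rewrite ler_norml => /andP[h _].
  have : La * z <= La * E r by apply: ler_wpM2l => //; lra.
  lra.
by rewrite F0 expr2; lra.
Qed.

(** The first integral [w'^2 + 2 F (w) = 0] is singular at [w = beta]. In the variable
[Y] with [w = beta exp (- Y^2)] it becomes the regular equation [Y' = K Y], where
[4 K (Y)^2 = G (Y^2) / Y^2], and [Y = +oo] corresponds to [w = 0]. *)
Lemma homoclinic_exists : exists w : R -> R, [/\ continuous w, w 0 = beta,
  (forall x, 0 <= x -> 0 < w x <= beta) /\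
    (forall x y, 0 <= x -> x <= y -> w y <= w x),
  (forall e, 0 < e -> exists X, 0 <= X /\ forall x, X <= x -> w x <= e)
  & forall x, 0 < x -> has_d2 w x (- f (w x))].
Proof.
have [g0 [hg0 /(_ erefl) g00]] := is_derive_G 0.
pose Q (r : R) : R := if r == 0 then g0 else G r / r.
have cQ : continuous Q.
  move=> r; case: (eqVneq r 0) => [->|r0].
    apply/continuous_withinNx; rewrite {2}/Q eqxx.
    have := is_derive_cvg_quot hg0; apply: cvg_trans; apply: near_eq_cvg.
    near=> y; rewrite /Q G0 !subr0 ifN//.
    by near: y; exact: nbhs_dnbhs_neq.
  have h : {for r, continuous (fun y : R => G y / y)}.
    have [d [hd _]] := is_derive_G r.
    apply: cvgM; first exact: is_derive_continuous hd.
    by apply: cvgV => //; exact: cvg_id.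
  rewrite /prop_for /continuous_at {2}/Q ifN//; apply: cvg_trans h.
  apply: near_eq_cvg.
  have : \forall y \near r, y != 0.
    case: (ltP 0 r) => hr.
      by have := near_above hr; apply: filterS => y y0; rewrite gt_eqF.
    have : \forall y \near r, r - 1 < y < 0.
      by apply: near_between; move: r0; rewrite neq_lt; lra.
    by apply: filterS => y /andP[_ y0]; rewrite lt_eqF.
  by apply: filterS => y y0; rewrite /Q ifN.
have Q0 r : 0 <= r -> 0 < Q r.
  rewrite le_eqVlt => /predU1P[<-|r0]; first by rewrite /Q eqxx.
  by rewrite /Q gt_eqF// divr_gt0// G_gt0.
have [c _ hc] := EVT_max ler01 (continuous_subspaceT cQ).
pose M := `|Q c| + 2 * La.
have QM r : 0 <= r -> Q r <= M.
  move=> r0; have La0' := La0; case: (leP r 1) => r1.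
    have := hc r; rewrite in_itv/= r0 r1 => /(_ isT) h.
    by rewrite /M; have := ler_norm (Q c); lra.
  have r0' : 0 < r by lra.
  rewrite /Q gt_eqF// ler_pdivrMr//.
  have := G_le r0'; have : 2 * La <= 2 * La * r by rewrite ler_peMr//; lra.
  have : 0 <= `|Q c| * r by rewrite mulr_ge0.
  by rewrite /M; lra.
pose K y := Num.sqrt (Q (y ^+ 2)) / 2.
have cK : continuous K.
  move=> y; apply: cvgM; last exact: cvg_cst.
  apply: (@continuous_comp _ _ _ (fun y : R => Q (y ^+ 2)) Num.sqrt); last exact: sqrt_continuous.
  apply: (@continuous_comp _ _ _ (fun y : R => y ^+ 2) Q); last exact: cQ.
  exact: is_derive_continuous (is_derive_fun_sqr (is_derive_fun_id y)).
have K0 y : 0 < K y by rewrite divr_gt0// sqrtr_gt0 Q0// sqr_ge0.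
have KB y : K y <= 1 + M.
  have q0 := Q0 _ (sqr_ge0 y); have qM := QM _ (sqr_ge0 y).
  have := sqr_sqrtr (ltW q0); have := sqrtr_ge0 (Q (y ^+ 2)); rewrite /K.
  set s := Num.sqrt _ => s0 e; rewrite expr2 in e.
  by case: (leP s 1) => s1; [lra|nra].
have [Y [Y0 hY Ymono Yinf]] := autonomous_flow cK K0 KB.
have Ymono' x y : x <= y -> Y x <= Y y.
  by rewrite le_eqVlt => /predU1P[->//|/Ymono/ltW].
have Yge0 x : 0 <= x -> 0 <= Y x by move=> ?; rewrite -Y0; exact: Ymono'.
pose w x := E (Y x ^+ 2).
have hw (x : R) : is_derive x 1 w (- w x * (2 * Y x * K (Y x))).
  exact: is_derive_fun_comp (is_derive_E _) (is_derive_fun_sqr (hY x)).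
have w_le x : w x < beta \/ w x = beta.
  case: (eqVneq (Y x ^+ 2) 0) => [e|n].
    by right; rewrite /w e /E oppr0 expR0 mulr1.
  by left; apply: E_lt; rewrite lt_neqAle eq_sym n sqr_ge0.
have w1 (x : R) : 0 < x -> is_derive x 1 w (- Num.sqrt (- 2 * F (w x))).
  move=> x0; apply: is_derive_eq (hw x) _.
  have y0 : 0 < Y x by rewrite -Y0; exact: Ymono.
  have y20 : 0 < Y x ^+ 2 by rewrite exprn_gt0.
  have wx := E_gt0 (Y x ^+ 2).
  have -> : - 2 * F (w x) = (w x * Y x) ^+ 2 * Q (Y x ^+ 2).
    rewrite /Q gt_eqF// /G -/(w x); field.
    by rewrite !gt_eqF.
  rewrite sqrtrM ?sqr_ge0// sqrtr_sqr ger0_norm; last by rewrite mulr_ge0// ltW.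
  by rewrite /K; field.
exists w; split.
- by move=> x; exact: is_derive_continuous (hw x).
- by rewrite /w Y0 expr0n /E /= oppr0 expR0 mulr1.
- split.
    by move=> x x0; rewrite /w E_gt0 /=; case: (w_le x); rewrite -/(w x) => h; [exact: ltW|rewrite h].
  move=> x y x0 xy; rewrite /w /E ler_pM2l// ler_expR lerN2.
  have := Yge0 x x0; have := Ymono' x y xy; rewrite !expr2; nra.
- move=> e e0; have [X [X0 hX]] := Yinf (1 + beta / e).
  exists X; split => // x Xx; rewrite /w /E expRN ler_pdivrMr ?expR_gt0//.
  have h1 := expR_ge1Dx (Y x ^+ 2).
  have h2 : 1 + beta / e <= Y x by apply: (le_trans hX); exact: Ymono'.
  have h3 : 0 < beta / e by rewrite divr_gt0.
  have h4 : beta / e <= Y x ^+ 2 by rewrite expr2; nra.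
  rewrite [leRHS]mulrC -ler_pdivrMr//; lra.
- move=> x x0; exists (fun y => - Num.sqrt (- 2 * F (w y))); split.
    by have := near_above x0; apply: filterS => y; exact: w1.
  have wb : 0 < w x < beta.
    rewrite E_gt0 /=; apply: E_lt; rewrite exprn_gt0// -Y0; exact: Ymono.
  have Fw : 0 < - 2 * F (w x) by have := Fneg wb; lra.
  have h1 := is_derive_fun_scale (- 2) (is_derive_fun_comp (hF (w x)) (w1 x x0)).
  have h := is_derive_fun_opp (@is_derive_fun_comp R Num.sqrt (fun y => - 2 * F (w y)) x _ _
    (is_derive1_sqrt Fw) h1).
  apply: is_derive_eq h _; field.
  by rewrite gt_eqF// sqrtr_gt0.
Unshelve. all: by end_near. Qed.

End Homoclinic.

(** * The alternative on a half-line *)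

Section Alternative.
Context {R : realType}.
Variables (f F : R -> R) (a beta : R).
Hypothesis hf : bistable f a.
Hypothesis F0 : F 0 = 0.
Hypothesis hF : forall x : R, is_derive x 1 F (f x).
Hypothesis hbeta : a < beta < 1.
Hypothesis Fbeta : F beta = 0.

Variables (U : R -> R -> R) (V : R -> R).
Hypothesis hU : halfline_solution f U.
Hypothesis hV : forall x, 0 <= x -> U t x @[t --> +oo] --> V x.

Lemma profile_spreads (x0 : R) : 0 <= x0 -> beta < V x0 ->
  (forall x y, 0 <= x -> x <= y -> V x <= V y) /\
  (forall e, 0 < e -> exists X, 0 <= X /\ forall x, X <= x -> 1 - e <= V x).
Proof.
move=> x00 hx0; have [La La0 fL] := bistable_lipschitz hf.
have fM s : 0 <= s <= 1 -> `|f s| <= La.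
  move=> sI; have := fL s 0 sI ltac:(lra).
  rewrite (bistable_f0 hf) !subr0 (@ger0_norm _ s); last by lra.
  by move=> h; apply: (le_trans h); rewrite ger_pMr//; lra.
have [W [W1 [WV hW hW1]]] := profile_steady fM hU hV (bistable_continuous hf) fL.
have hW1' (x : R) : 0 <= x -> is_derive x 1 W1 (- f (W x)).
  by move=> x0'; rewrite WV//; exact: hW1.
have W01 x : 0 <= x -> 0 <= W x <= 1.
  by move=> x0'; rewrite WV//; exact: profile_range hU hV _ x0'.
have := steady_above_beta hf F0 hF hbeta Fbeta hW hW1' W01 x00.
rewrite WV// => /(_ hx0)[h1 h2]; split.
  by move=> x y x0' xy; rewrite -!WV//; [exact: h1|lra].
move=> e /h2[X hX]; exists (Num.max 0 X); split; first by rewrite le_max lexx.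
by move=> x; rewrite ge_max => /andP[x0' Xx]; rewrite -WV//; exact: hX.
Qed.

(** The homoclinic steady state, cut at the level [V x1], is a barrier: it dominates [U]
beyond [x1] at all times, because [U] is small in the past and because the stable zero 0
damps the possible excess of a small [U] over the barrier. *)
Lemma profile_blocked (x1 : R) : 0 <= x1 -> V x1 <= beta ->
  (forall t x, 0 <= x -> U t x <= V x) ->
  (forall e, 0 < e -> exists T, forall t x, t <= T -> 0 < x -> U t x <= e) ->
  (forall x, x1 <= x -> V x <= V x1) /\
  (forall e, 0 < e -> exists X, 0 <= X /\ forall x, X <= x -> V x <= e).
Proof.
move=> x10 Vb UV Usmall; have ha := bistable_a hf; have hb := hbeta.
have [La La0 fL] := bistable_lipschitz hf.
have [de [mu [de01 mu0 hmu]]] := bistable_contraction hf.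
have b0 : 0 < V x1 by have := hs_range hU 0 x10; have := UV 0 x1 x10; lra.
have fLa s : 0 <= s <= beta -> `|f s| <= La * s.
  move=> sI; have := fL s 0 ltac:(lra) ltac:(lra).
  by rewrite (bistable_f0 hf) !subr0 (@ger0_norm _ s)//; lra.
have [w [cw w0 [w01 wmono] winf hw]] := homoclinic_exists F0 hF Fbeta (ltac:(lra) : 0 < beta)
  (potential_lt0 hf F0 hF hbeta Fbeta) (bistable_pos hf hbeta) fLa.
have [xb xb0 wxb] : exists2 xb, 0 <= xb & w xb = V x1.
  have [X [X0 hX]] := winf _ b0.
  have mm : Num.min (w 0) (w X) <= V x1 <= Num.max (w 0) (w X).
    by rewrite ge_min le_max w0 hX// Vb orbT.
  have [c /[!in_itv]/= /andP[c0 _] e] := IVT X0 (continuous_subspaceT cw) mm.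
  by exists c.
have [T hT] := Usmall de ltac:(lra).
pose z t x := w (xb + x) - U t (x1 + x).
have hU1 := halfline_solution_shift x10 hU.
have cz : {within [set p : R * R | 0 <= p.2], continuous (fun p => z p.1 p.2)}.
  move=> p; apply: cvgB; last exact: (hs_continuous hU1).
  apply: (@continuous_subspaceT _ _ _ (fun p : R * R => w (xb + p.2))) => q.
  apply: (@continuous_comp _ _ _ (fun p : R * R => xb + p.2) w); last exact: cw.
  by apply: cvgD; [exact: cvg_cst|exact: cvg_snd].
have wU t x : 0 <= x -> 0 < w (xb + x) <= beta /\ 0 < U t (x1 + x) < 1.
  by move=> x0; split; [apply: w01; lra|exact: (hs_range hU1)].
have zge t x : 0 <= x -> - 1 <= z t x.
  by move=> x0; have := wU t x x0; rewrite /z; lra.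
have zb t : 0 <= z t 0 by rewrite /z !addr0 wxb subr_ge0 UV.
have zi t x k : 0 < x -> k * z t x <= f (w (xb + x)) - f (U t (x1 + x)) ->
    heat_ge z t x (k * z t x).
  move=> x0 hk; have [ut [uxx [h1 h2 h3]]] := hs_equation hU1 t x0.
  exists (0 - ut), (- f (w (xb + x)) - uxx); split; last by lra.
    exact: is_derive_fun_sub (is_derive_fun_cst _ _) h1.
  by apply: has_d2_sub h2; apply: has_d2_shift; apply: hw; lra.
have z0 (t p : R) : 0 <= z t `|p|.
  move: t p.
  apply: (ancient_nonneg (z := fun t (p : R) => z t `|p|) (C := 1) (T := T) ler01 mu0).
    move=> t0 t p tI.
    apply: (comparison_halfline (t1 := t) ler01 cz (fun s x _ => zge s x) (zge t0)
      (fun s _ => zb s)) => //; last by lra.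
    move=> s x sI x0 zneg; apply: zi => //.
    have := wU s x (ltW x0); move: zneg; rewrite /z => zneg hh.
    have := hT s (x1 + x) ltac:(lra) ltac:(lra) => hd.
    have := hmu (w (xb + x)) (U s (x1 + x)) ltac:(lra) ltac:(left; lra); lra.
  move=> zT t p tT; have e0 : 0 = - 0 * expR (La * (t - T)) by rewrite oppr0 mul0r.
  have zT' x : 0 <= x -> - 0 <= z T x.
    by move=> x0; rewrite oppr0 -(ger0_norm x0).
  rewrite [leLHS]e0.
  apply: (comparison_halfline (t1 := t) (lexx 0) cz (fun s x _ => zge s x) zT'
    (fun s _ => zb s)) => //; last by lra.
  move=> s x sI x0 zneg; apply: zi => //.
  have := wU s x (ltW x0); move: zneg; rewrite /z => zneg hh.
  have := fL (w (xb + x)) (U s (x1 + x)) ltac:(lra) ltac:(lra).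
  by rewrite (ltr0_norm zneg) ler_norml; lra.
have Vw x : 0 <= x -> V (x1 + x) <= w (xb + x).
  move=> x0; apply: (cvgy_le (hV (ltac:(lra) : 0 <= x1 + x)) (T := 0)) => t _.
  by have := z0 t x; rewrite (ger0_norm x0) /z subr_ge0.
split.
  move=> x x1x; have := Vw (x - x1) ltac:(lra).
  rewrite (_ : x1 + (x - x1) = x); last by ring.
  by move=> h; apply: (le_trans h); rewrite -wxb; apply: wmono; lra.
move=> e /winf[X [X0 hX]]; exists (x1 + X); split; first by lra.
move=> x Xx; have := Vw (x - x1) ltac:(lra).
rewrite (_ : x1 + (x - x1) = x); last by ring.
by move=> h; apply: (le_trans h); apply: hX; lra.
Qed.

End Alternative.

(** * Front-like solutions on the graph *)

Section Front.
Context {R : realType} {N : nat} (G : mgraph R N).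
Variables (f : R -> R) (u : R -> gpoint G -> R).
Hypothesis hu : entire_solution f u.

Lemma entire_heat_eq (e : gedge G) t x : edge_int e x ->
  heat_eq (fun t x => u t (gpt e x)) t x (f (u t (gpt e x))).
Proof.
move=> ex; exists (derive1 (fun s => u s (gpt e x)) t), (derive1 (edge_derive e (u t)) x).
split.
- by split; [exact: (sol_derivable_t hu)|rewrite derive1E].
- exists (edge_derive e (u t)); split.
    have := edge_int_near ex; apply: filterS => y ey.
    apply: interior_quot => //.
    exact: (sol_C1 hu t e).1 (edge_int_dom ey).
  by split; [exact: (sol_derivable_xx hu)|rewrite derive1E].
- by rewrite (sol_equation hu)//; ring.
Qed.

Lemma entire_halfline (j : 'I_N) : (forall t p, 0 < u t p < 1) ->
  halfline_solution f (fun t x => u t (outer G j x)).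
Proof.
move=> u01; split.
- have := @sol_continuous _ _ _ _ _ hu (inr j). exact.
- by move=> t x x0; exact: (@entire_heat_eq (inr j)).
- by move=> t x _; exact: u01.
Qed.

Lemma inner_notin_outer_path (i : 'I_N) (e : gedge G) x : edge_int e x -> e <> inr i ->
  ~ outer_path i (gpt e x).
Proof.
pose edge_of (p : gpoint G) := match p with Vtx _ => None | Inner e _ => Some e end.
move=> ex ne [y _ E]; apply: ne.
have := congr1 edge_of E; rewrite (gpt_int ex) /outer /gpt.
by case: insubP => [y' _ _|_] //= [].
Qed.

End Front.

Section FrontOrder.
Context {R : realType} {N : nat} (G : mgraph R N).
Variables (f : R -> R) (a : R) (phi : R -> R) (c : R) (i : 'I_N).
Hypothesis hf : bistable f a.
Hypothesis hphi : traveling_wave f a phi c.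
Variables (u : R -> gpoint G -> R) (v : gpoint G -> R).
Hypothesis hu : front_like f phi c i u.

Let u_range t p : 0 < u t p < 1.
Proof. by case: hu => _ + _; exact. Qed.

Lemma sup_bound (A : set R) (r e : R) : (forall s, A s -> 0 <= s <= 1) ->
  A r -> sup A <= e -> r <= e.
Proof.
move=> hA Ar; apply: le_trans; apply: sup_ubound => //.
by exists 1 => s /hA /andP[].
Qed.

Lemma sup_ge0_of (A : set R) : (forall s, A s -> 0 <= s <= 1) -> 0 <= sup A.
Proof.
move=> hA; have [->|/set0P[r Ar]] := eqVneq A set0; first by rewrite sup0.
have := sup_bound hA Ar (lexx _); have := hA r Ar; lra.
Qed.

Lemma front_past (e : R) : 0 < e -> exists T, forall t, t <= T ->
  (forall x, 0 <= x -> `|u t (outer G i x) - phi (- x - c * t)| <= e) /\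
  (forall p, ~ outer_path i p -> u t p <= e).
Proof.
move=> e0; case: hu => _ _ /cvgrPdist_le/(_ e e0)[T [_ hT]].
exists (T - 1) => t tT; have := hT t ltac:(lra); rewrite /= sub0r normrN.
set A := (X in sup X + _); set B := (X in _ + sup X) => hAB.
have hA s : A s -> 0 <= s <= 1.
  move=> [x x0 <-]; rewrite normr_ge0 ler_norml /=.
  by have := u_range t (outer G i x); have := wave_range hphi (- x - c * t); lra.
have hB s : B s -> 0 <= s <= 1.
  move=> [p _ <-]; rewrite normr_ge0 ler_norml /=.
  by have := u_range t p; lra.
have A0 := sup_ge0_of hA; have B0 := sup_ge0_of hB.
rewrite ger0_norm in hAB; last by rewrite addr_ge0.
split.
  by move=> x x0; apply: (sup_bound hA); [exists x|lra].
move=> p hp; have : `|u t p| <= e by apply: (sup_bound hB); [exists p|lra].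
by rewrite ler_norml => /andP[].
Qed.

Lemma wave_behind (e : R) : 0 < e -> exists Y, forall y, y <= Y -> 1 - e <= phi y.
Proof.
move=> e0; have /cvgrPdist_le/(_ e e0)[Y [_ hY]] := wave_ninfty hphi.
by exists (Y - 1) => y yY; have := hY y ltac:(lra); rewrite ler_norml; lra.
Qed.

Lemma wave_ahead (e : R) : 0 < e -> exists Y, forall y, Y <= y -> phi y <= e.
Proof.
move=> e0; have /cvgrPdist_le/(_ e e0)[Y [_ hY]] := wave_pinfty hphi.
by exists (Y + 1) => y yY; have := hY y ltac:(lra); rewrite /= ler_norml; lra.
Qed.

(** For a delay [h] so long that the wave crosses its transition layer, [u (h + t)] is
close to 1 wherever [u t] is not yet close to 0, for very negative [t]. So wherever
[u (h + t) < u t] in the past, both values are close to the same stable zero of [f], and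
the difference is damped. *)
Lemma front_delay_order : (0 < N)%N -> exists H, forall h, H <= h ->
  forall t p, u t p <= u (h + t) p.
Proof.
move=> N0; case: (hu) => hsol _ _.
have [La La0 fL] := bistable_lipschitz hf.
have [de [mu [de01 mu0 hmu]]] := bistable_contraction hf.
have de2 : 0 < de / 2 by lra.
have [Y1 hY1] := wave_behind de2; have [Y2 hY2] := wave_ahead de2.
have [T hT] := front_past de2; have c0 := wave_speed hphi.
(* c h >= Y2 - Y1: the wave crosses its transition layer during the delay *)
exists (Num.max 0 ((Y2 - Y1) / c)) => h; rewrite ge_max => /andP[h0].
rewrite ler_pdivrMr// => hc.
pose z t p := u (h + t) p - u t p.
have z1 t p : - 1 <= z t p.
  by have := u_range t p; have := u_range (h + t) p; rewrite /z; lra.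
have zi t (e : gedge G) x k : edge_int e x ->
    k * z t (gpt e x) <= f (u (h + t) (gpt e x)) - f (u t (gpt e x)) ->
    heat_ge (fun t x => z t (gpt e x)) t x (k * z t (gpt e x)).
  move=> ex hk; have [yt [yxx [h1 h2 h3]]] := entire_heat_eq hsol (h + t) ex.
  have hz : heat_ge (fun t x => u (h + t) (gpt e x)) t x (f (u (h + t) (gpt e x))).
    by exists yt, yxx; split => //; [exact: is_derive_fun_shift|lra].
  exact: heat_ge_le (heat_eq_sub_ge hz (entire_heat_eq hsol t ex)) hk.
have cz (e : gedge G) : {within [set p : R * R | edge_dom e p.2],
    continuous (fun p : R * R => z p.1 (gpt e p.2))}.
  have hce := @sol_continuous _ _ _ _ _ hsol e.
  move=> p; apply: cvgB; last exact: hce.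
  have hs : continuous (fun p : R * R => (h + p.1, p.2)).
    move=> q; have h1 : h + r.1 @[r --> q] --> h + q.1.
      by apply: cvgD; [exact: cvg_cst|exact: cvg_fst].
    have h2 : r.2 @[r --> q] --> q.2 by exact: cvg_snd.
    exact: cvg_pair h1 h2.
  exact: (within_continuous_comp (B := [set p : R * R | edge_dom e p.2])
    hce hs).
pose D t (e : gedge G) x := edge_derive e (u (h + t)) x - edge_derive e (u t) x.
have zD t (e : gedge G) x : edge_dom e x ->
    (z t (gpt e y) - z t (gpt e x)) / (y - x) @[y --> within (edge_dom e) x^'] --> D t e x.
  move=> ex.
  have hq s : (u s (gpt e y) - u s (gpt e x)) / (y - x) @[y --> within (edge_dom e) x^']
      --> edge_derive e (u s) x by exact: (sol_C1 hsol s e).1.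
  rewrite (_ : (fun y => _) = (fun y => (u (h + t) (gpt e y) - u (h + t) (gpt e x)) / (y - x)
    - (u t (gpt e y) - u t (gpt e x)) / (y - x))); first exact: cvgB.
  by apply/funext => y; rewrite /z -mulrBl; congr (_ / _); ring.
have zK t V :
     \sum_(b : cedge G | csrc b == V) thickness G (inl b) * D t (inl b) 0
     + \sum_(b : cedge G | ctgt b == V) thickness G (inl b) * (- D t (inl b) (clen b))
     + \sum_(j < N | attach G j == V) thickness G (inr j) * D t (inr j) 0 = 0.
  have := sol_kirchhoff hsol (h + t) V; have := sol_kirchhoff hsol t V.
  have split_sum (I : finType) (P : pred I) (A B C : I -> R) :
      (forall b, A b = B b - C b) ->
      \sum_(b | P b) A b = \sum_(b | P b) B b - \sum_(b | P b) C b.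
    by move=> h'; rewrite -sumrB; apply: eq_bigr => b _.
  rewrite /kirchhoff => k1 k2.
  rewrite (split_sum _ _ (fun b => thickness G (inl b) * D t (inl b) 0)
    (fun b => thickness G (inl b) * edge_derive (inl b) (u (h + t)) 0)
    (fun b => thickness G (inl b) * edge_derive (inl b) (u t) 0)); last by move=> b; rewrite -mulrBr.
  rewrite (split_sum _ _ (fun b => thickness G (inl b) * - D t (inl b) (clen b))
    (fun b => thickness G (inl b) * - edge_derive (inl b) (u (h + t)) (clen b))
    (fun b => thickness G (inl b) * - edge_derive (inl b) (u t) (clen b))); last first.
    by move=> b; rewrite -mulrBr /D opprB opprK [in RHS]addrC.
  rewrite (split_sum _ _ (fun b => thickness G (inr b) * D t (inr b) 0)
    (fun b => thickness G (inr b) * edge_derive (inr b) (u (h + t)) 0)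
    (fun b => thickness G (inr b) * edge_derive (inr b) (u t) 0)); last by move=> b; rewrite -mulrBr.
  lra.
move=> t p; rewrite -subr_ge0; move: t p.
apply: (ancient_nonneg (z := z) (C := 1) (T := T - h) ler01 mu0).
  move=> t0 t p tI.
  apply: (comparison_graph (t1 := t) N0 ler01 cz zD zK (fun s q _ => z1 s q) (z1 t0)) => //; last by lra.
  move=> s e x sI ex zneg; apply: zi => //.
  set r1 := u (h + s) (gpt e x); set r2 := u s (gpt e x).
  have r12 : r1 <= r2 by move: zneg; rewrite /z -/r1 -/r2; lra.
  have r1I : 0 < r1 < 1 by exact: u_range.
  have r2I : 0 < r2 < 1 by exact: u_range.
  suff : (0 <= r1 /\ r2 <= de) \/ (1 - de <= r1 /\ r2 <= 1).
    by move=> /(hmu _ _ r12); rewrite /z -/r1 -/r2; lra.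
  have [h1 h2] := hT s ltac:(lra); have [h3 h4] := hT (h + s) ltac:(lra).
  have [ei|ei] := pselect (e = inr i); last first.
    have := h2 _ (inner_notin_outer_path ex ei); rewrite -/r2 => ?; left; lra.
  have x0 : 0 <= x by move: ex; rewrite ei => /= /ltW.
  have := h1 x x0; have := h3 x x0; rewrite /outer -ei -/r1 -/r2.
  rewrite !ler_norml => b1 b2.
  case: (leP Y2 (- x - c * s)) => hy.
    by left; have := hY2 _ hy; lra.
  right; have := hY1 (- x - c * (h + s)) ltac:(lra); lra.
move=> zT t p tT.
have e0 : 0 = - 0 * expR (La * (t - (T - h))) by rewrite oppr0 mul0r.
have zT' q : - 0 <= z (T - h) q by rewrite oppr0; exact: zT.
rewrite [leLHS]e0.
apply: (comparison_graph (t1 := t) N0 (lexx 0) cz zD zK (fun s q _ => z1 s q) zT') => //; last by lra.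
move=> s e x sI ex zneg; apply: zi => //.
have h1 := u_range (h + s) (gpt e x); have h2 := u_range s (gpt e x).
have := fL (u (h + s) (gpt e x)) (u s (gpt e x)) ltac:(lra) ltac:(lra).
by rewrite (ltr0_norm zneg) ler_norml /z; lra.
Unshelve. all: by end_near. Qed.

Lemma front_le_profile : (0 < N)%N -> limit_profile u v -> forall t p, u t p <= v p.
Proof.
move=> N0 hv t p; have [H hH] := front_delay_order N0.
apply: (cvgy_ge (hv p) (T := H + t)) => s sH.
by have := hH (s - t) ltac:(lra) t p; rewrite subrK.
Qed.

End FrontOrder.

Lemma cvgy_intro {R : realType} (g : R -> R) (l : R) :
  (forall e, 0 < e -> exists X, forall x, X <= x -> `|g x - l| <= e) ->
  g x @[x --> +oo] --> l.
Proof.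
move=> h; apply/cvgrPdist_le => e e0; have [X hX] := h e e0.
near=> x; rewrite distrC; apply: hX; near: x.
by apply: nbhs_pinfty_ge; exact: num_real.
Unshelve. all: by end_near. Qed.

Theorem theorem2p1 (R : realType) (N : nat) (hN : (2 <= N)%N) (G : mgraph R N)
    (f : R -> R) (a : R) (hf : bistable f a)
    (beta : R) (hbeta : a < beta < 1) (hFbeta : primitive f beta = 0)
    (phi : R -> R) (c : R) (hphi : traveling_wave f a phi c)
    (i j : 'I_N)
    (u : R -> gpoint G -> R) (hu : front_like f phi c i u)
    (v : gpoint G -> R) (hv : limit_profile u v) :
  let to1 := v (outer G j x) @[x --> +oo] --> (1 : R) in
  let to0 := v (outer G j x) @[x --> +oo] --> (0 : R) in
  let Pj := Vtx (attach G j) in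
  [/\ to1 \/ to0,
      (beta < v Pj -> to1) /\ (to0 -> v Pj <= beta),
      (i <> j -> (to1 <-> beta < v Pj) /\ (to0 <-> v Pj <= beta)),
      (to1 -> forall x y : R, 0 <= x -> x <= y ->
         v (outer G j x) <= v (outer G j y))
    & (to0 -> forall x y : R, 0 <= x -> x <= y ->
         v (outer G j y) <= v (outer G j x))].
Proof.
move=> to1 to0 Pj; have N0 : (0 < N)%N by exact: leq_trans hN.
have ha := bistable_a hf; have cf := bistable_continuous hf.
have [F [F0 hF]] := antiderivative_exists cf.
have Fbeta : F beta = 0 by rewrite -hFbeta (primitive_antiderivative cf F0 hF)//; lra.
have uv := front_le_profile hf hphi hu N0 hv.
case: (hu) => hsol u01 _.
have hU := entire_halfline hsol j u01.
pose V x := v (outer G j x).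
have hV x : 0 <= x -> u t (outer G j x) @[t --> +oo] --> V x by move=> _; exact: hv.
have PjE : V 0 = v Pj by rewrite /V /outer gpt_attach.
have V01 x : 0 <= x -> 0 <= V x <= 1.
  move=> x0; have := u01 0 (outer G j x); have := uv 0 (outer G j x); rewrite -/(V x).
  have : V x <= 1.
    by apply: (cvgy_le (hV x x0) (T := 0)) => t _; have := u01 t (outer G j x); lra.
  lra.
have excl : to1 -> to0 -> False.
  have e4 : 0 < 1 / 4 :> R by lra.
  move=> /cvgy_eventually/(_ e4)[T hT] /cvgy_eventually/(_ e4)[T' hT'].
  have := hT (Num.max T T'); have := hT' (Num.max T T').
  by rewrite !le_max !lexx orbT /= !ler_norml => /(_ isT) h1 /(_ isT) h2; lra.
have spread x0 : 0 <= x0 -> beta < V x0 ->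
    to1 /\ forall x y, 0 <= x -> x <= y -> V x <= V y.
  move=> x00 hx0.
  have [mono lim1] := profile_spreads hf F0 hF hbeta Fbeta hU hV x00 hx0.
  split=> //; apply: cvgy_intro => e /lim1[X [X0 hX]]; exists X => x Xx.
  by rewrite -/(V x) ler_norml; have := hX x Xx; have := V01 x ltac:(lra); lra.
(* on its own path u already exceeds beta far out at an early time *)
have own : i = j -> exists x0, 0 <= x0 /\ beta < V x0.
  move=> ij; have e0 : 0 < (1 - beta) / 4 by lra.
  have [T hT] := front_past hphi hu e0; have [h1 _] := hT T (lexx _).
  have [Y hY] := wave_behind hphi e0.
  pose x0 := `|Y + c * T|; have x00 : 0 <= x0 by exact: normr_ge0.
  exists x0; split => //; have := uv T (outer G j x0); rewrite -/(V x0) => hx.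
  have := h1 x0 x00; rewrite ij ler_norml.
  have := hY (- x0 - c * T).
  by have := ler_norm (- (Y + c * T)); rewrite normrN -/x0; lra.
have small e : i <> j -> 0 < e -> exists T, forall t x, t <= T -> 0 < x ->
    u t (outer G j x) <= e.
  move=> ij e0; have [T hT] := front_past hphi hu e0; exists T => t x tT x0.
  have [_] := hT t tT; apply; apply: inner_notin_outer_path => // -[ji].
  by apply: ij; rewrite ji.
have block x1 : i <> j -> 0 <= x1 -> V x1 <= beta ->
    (forall x, x1 <= x -> V x <= V x1) /\ to0.
  move=> ij x10 hx1.
  have [dec lim0] := profile_blocked hf F0 hF hbeta Fbeta hU hV x10 hx1
    (fun t x _ => uv t (outer G j x)) (fun e => small e ij).
  split=> //; apply: cvgy_intro => e /lim0[X [X0 hX]]; exists X => x Xx.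
  by rewrite -/(V x) ler_norml; have := hX x Xx; have := V01 x ltac:(lra); lra.
have low x : to0 -> 0 <= x -> V x <= beta.
  by move=> h0 x0; rewrite leNgt; apply/negP => /(spread x x0)[h1 _]; exact: excl.
have to0_ij : to0 -> i <> j.
  move=> h0 /own[x0 [x00 hx0]]; have := low x0 h0 x00; lra.
split.
- have [ij|ij] := pselect (i = j).
    by have [x0 [x00 hx0]] := own ij; left; have [] := spread x0 x00 hx0.
  case: (leP (V 0) beta) => h; first by right; have [] := block 0 ij (lexx 0) h.
  by left; have [] := spread 0 (lexx 0) h.
- rewrite -PjE; split; first by move=> h; have [] := spread 0 (lexx 0) h.
  by move=> h0; exact: low.
- move=> ij; rewrite -PjE; split; split.
  + move=> h1; rewrite ltNge; apply/negP => h; have [_ h0] := block 0 ij (lexx 0) h.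
    exact: excl.
  + by move=> h; have [] := spread 0 (lexx 0) h.
  + by move=> h0; exact: low.
  + by move=> h; have [] := block 0 ij (lexx 0) h.
- move=> h1; have e0 : 0 < (1 - beta) / 2 by lra.
  have [T hT] := cvgy_eventually h1 e0.
  have T0 : T <= Num.max 0 T by rewrite le_max lexx orbT.
  have m0 : 0 <= Num.max 0 T by rewrite le_max lexx.
  have hb : beta < V (Num.max 0 T).
    by have := hT _ T0; rewrite ler_norml -/(V _); lra.
  by have [_] := spread _ m0 hb.
- move=> h0 x y x0 xy.
  by have [+ _] := block x (to0_ij h0) x0 (low x h0 x0); apply.
Qed.
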